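(* Assume that the mapping $F$ is monotone on $X$, i.e. $\langle F(x)-F(y),x-y\rangle\ge0$ for all $x,y\in X$. Suppose that each $X_i$ is nonempty, closed, convex and bounded with $\|x\|_i\le B_i$ for all $x\in X_i$, that $\|F_i(x)\|_{*i}\le C_i$ for all $x\in X$ and all $i$, and that the samples $\{\xi_k\}$, $\{\tilde\xi_k\}$ are i.i.d. and satisfy the unbiasedness and bounded-variance assumptions (R2)–(R3) of the context. Let the iterates be generated by the stochastic mirror-prox algorithm described in the context. Let $r<1$ be an arbitrary scalar, let the stepsize sequence $\{\gamma_k\}$ be non-increasing, and let $\bar y_k$ be the averaged sequence given by $$\Gamma_{k+1}=\Gamma_k+\gamma_k^r,\qquad \bar y_{k+1}=\frac{\Gamma_k\bar y_k+\gamma_k^ry_{k+1}}{\Gamma_{k+1}},\qquad \Gamma_0=0,\ \bar y_0=0 .$$ Then, for any $K\ge1$, $$\mathsf E[G(\bar y_K)]\le\Big(\sum_{k=0}^{K-1}\gamma_k^r\Big)^{-1}\Big(4\gamma_{K-1}^{r-1}\sum_{i=1}^dL_{\omega_i}B_i^2+\sum_{k=0}^{K-1}\gamma_k^{r+1}\sum_{i=1}^d\Big(\frac2{\mu_{\omega_i}}\Big)\big(2C_i^2+\tilde\nu_i^2+1.25\,\nu_i^2\big)\Big),$$ where $G(x)=\sup_{y\in X}\langle F(y),x-y\rangle$ for $x\in X$. Moreover, if $\gamma_k=\frac{\gamma_0}{\sqrt{k+1}}$ for some $\gamma_0>0$, then for any $K>\max\big\{\big\lceil\big(\frac{3-r}2\big)^{\frac2{1-r}}\big\rceil,3\big\}$,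 $$\mathsf E[G(\bar y_K)]\le\frac{\mathcal M}{\sqrt K},$$ where $$\mathcal M=(2-r)\,2^{1-0.5r}\Bigg(\frac{4\sum_{i=1}^dL_{\omega_i}B_i^2}{\gamma_0}+\frac{\gamma_0\sum_{i=1}^d\big(\frac2{\mu_{\omega_i}}\big)\big(2C_i^2+\tilde\nu_i^2+1.25\,\nu_i^2\big)}{1-r}\Bigg).$$
   Context: **Problem.** Let $d,n_1,\dots,n_d\ge 1$, $n=\sum_{i=1}^d n_i$, and write $x\in\mathbb R^n$ as $x=(x^1;\dots;x^d)$ with $x^i\in\mathbb R^{n_i}$. $\|\cdot\|_i$ is a norm on $\mathbb R^{n_i}$ with dual norm $\|x\|_{*i}=\sup_{\|y\|_i\le 1}\langle y,x\rangle$; on $\mathbb R^n$, $\langle u,v\rangle=\sum_i\langle u^i,v^i\rangle$. Let $X_i\subset\mathbb R^{n_i}$, $X=\prod_{i=1}^d X_i$, let $\xi$ be a random vector in $\mathbb R^m$, let $F(\cdot,\cdot):X\times\mathbb R^m\to\mathbb R^n$ be a random mapping with blocks $F_i(\cdot,\cdot)\in\mathbb R^{n_i}$, and let $F(x)=\mathsf E[F(x,\xi)]$ (assumed finite), with blocks $F_i(x)$. The underlying problem is to find $x^*\in X$ with $\langle F(x^* ),x-x^*\rangle\ge 0$ for all $x\in X$. **Prox mappings.** For each $i$, $\omega_i:X_i\to\mathbb R$ is continuously differentiable, strongly convex with parameter $\mu_{\omega_i}>0$: $\omega_i(y)\ge\omega_i(x)+\langle\nabla\omega_i(x),y-x\rangle+\frac{\mu_{\omega_i}}2\|x-y\|_i^2$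 for $x,y\in X_i$, and satisfies $\omega_i(y)\le\omega_i(x)+\langle\nabla\omega_i(x),y-x\rangle+\frac{L_{\omega_i}}2\|x-y\|_i^2$ for $x,y\in X_i$. Define $D_i(x,y)=\omega_i(y)-\omega_i(x)-\langle\nabla\omega_i(x),y-x\rangle$ for $x,y\in X_i$ and $P_i(x,y)=\operatorname{argmin}_{z\in X_i}\{\langle y,z\rangle+D_i(x,z)\}$ for $x\in X_i$, $y\in\mathbb R^{n_i}$. **Stochastic mirror-prox algorithm (all blocks updated).** Given a random initial point $x_0\in X$ and positive stepsizes $\gamma_k$: at each iteration $k\ge0$, with realizations $\tilde\xi_k,\xi_k$ of $\xi$, set for all $i=1,\dots,d$ $$y_{k+1}^i=P_i\big(x_k^i,\gamma_kF_i(x_k,\tilde\xi_k)\big),\qquad x_{k+1}^i=P_i\big(x_k^i,\gamma_kF_i(y_{k+1},\xi_k)\big),$$ where all blocks of $y_{k+1}$ enter $F_i(y_{k+1},\xi_k)$. **Sampling assumptions.** $\{\xi_k\}$ and $\{\tilde\xi_k\}$ are i.i.d. and independent of each other (and of $x_0$). (R2) $\mathsf E[F(x,\tilde\xi_k)\mid x]=\mathsf E[F(x,\xi_k)\mid x]=F(x)$ for all $x\in X$, $k\ge0$. (R3) There are $\nu_i,\tilde\nu_i>0$ such that, for all $i$, all $k\ge 0$ and all $x\in X$, $\mathsf E[\|F_i(x,\tilde\xi_k)-F_i(x)\|_{*i}^2\mid x]\le\tilde\nu_i^2$ and $\mathsf E[\|F_i(x,\xi_k)-F_i(x)\|_{*i}^2\mid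 x]\le\nu_i^2$. *)

(* Defs.v *)
From mathcomp Require Import all_boot all_order all_algebra.
From mathcomp Require Import all_classical all_reals all_analysis.

Set Implicit Arguments.
Unset Strict Implicit.
Unset Printing Implicit Defensive.

Import Order.TTheory GRing.Theory Num.Theory numFieldNormedType.Exports.

Local Open Scope classical_set_scope.
Local Open Scope ring_scope.

(* R^n with its Borel sigma-algebra; convertible to 'rV[R]_n. *)
Notation borel_rV R n := (g_sigma_algebraType (@open 'rV[R]_n)).

Section Euclidean.
Context {R : realType}.

Definition dot {n} (u v : 'rV[R]_n) : R := \sum_(j < n) u 0 j * v 0 j.

Definition is_norm {n} (N : 'rV[R]_n -> R) : Prop :=
  [/\ forall x, N x = 0 -> x = 0,
      forall a x, N (a *: x) = `|a| * N x &
      forall x y, N (x + y) <= N x + N y].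

Definition dual_norm {n} (N : 'rV[R]_n -> R) (x : 'rV[R]_n) : R :=
  sup [set dot y x | y in [set y | N y <= 1]].

(* [g] is a continuous gradient field of [f] on [A].  Since [f] is only meant
   to be defined on [A], which may have empty interior, both continuity and
   differentiability are relative to [A]. *)
Definition C1_on {n} (A : set 'rV[R]_n) (f : 'rV[R]_n -> R)
    (g : 'rV[R]_n -> 'rV[R]_n) : Prop :=
  {within A, continuous g} /\
  forall x, A x -> forall e, 0 < e ->
    \forall y \near within A (nbhs x),
      `|f y - f x - dot (g x) (y - x)| <= e * `|y - x|.

(* The Bregman distance D(x, y) generated by [f] with gradient [g]. *)
Definition bregman {n} (f : 'rV[R]_n -> R) (g : 'rV[R]_n -> 'rV[R]_n)
    (x y : 'rV[R]_n) : R :=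
  f y - f x - dot (g x) (y - x).

Definition argmin {n} (A : set 'rV[R]_n) (h : 'rV[R]_n -> R) : set 'rV[R]_n :=
  [set z | A z /\ forall z', A z' -> h z <= h z'].

(* The default value 0 is only used when there is no minimizer. *)
Definition prox {n} (A : set 'rV[R]_n) (f : 'rV[R]_n -> R)
    (g : 'rV[R]_n -> 'rV[R]_n) (x y : 'rV[R]_n) : 'rV[R]_n :=
  xget 0 (argmin A (fun z => dot y z + bregman f g x z)).

End Euclidean.

(* Vectors of R^(n_1 + ... + n_d) are row vectors indexed by \sum_i n i, whose
   i-th block is [submxrow x i]. *)
Section Blocks.
Context {R : realType} {d : nat} {n : 'I_d -> nat}.
Local Notation V := 'rV[R]_(\sum_i n i).

Definition bdot (u v : V) : R := \sum_i dot (submxrow u i) (submxrow v i).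

Definition setprod (X : forall i, set 'rV[R]_(n i)) : set V :=
  [set x | forall i, X i (submxrow x i)].

(* [ereal_sup], so that no boundedness is presupposed. *)
Definition gap (X : set V) (F : V -> V) (x : V) : \bar R :=
  ereal_sup [set (bdot (F y) (x - y))%:E | y in X].

End Blocks.

Section Averaging.
Context {R : realType} {N : nat}.
Variables (gamma : nat -> R) (r : R).

Fixpoint Gam (k : nat) : R :=
  if k is k'.+1 then Gam k' + gamma k' `^ r else 0.

Fixpoint ybar (y : nat -> 'rV[R]_N) (k : nat) : 'rV[R]_N :=
  if k is k'.+1 then
    (Gam k'.+1)^-1 *: (Gam k' *: ybar y k' + gamma k' `^ r *: y k'.+1)
  else 0.

End Averaging.

Section Probability.
Context {R : realType} {dT : measure_display} {T : measurableType dT}.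
Variable P : probability T R.

(* Meaningful when the coordinates of [Z] are integrable; [fine] sends an
   infinite expectation to 0. *)
Definition vec_expectation {n} (Z : T -> 'rV[R]_n) : 'rV[R]_n :=
  \row_j fine 'E_P[fun w => Z w 0 j].

Definition mutually_independent (I : eqType) (S : I -> set (set T)) : Prop :=
  forall (J : seq I) (A : I -> set T), uniq J ->
    (forall i, i \in J -> S i (A i)) ->
    P (\bigcap_(i in [set` J]) A i) = (\prod_(i <- J) P (A i))%E.

Definition sigma_rv {dT'} {T' : measurableType dT'} (Z : T -> T') :
    set (set T) :=
  preimage_set_system setT Z measurable.

Definition same_distribution {dT'} {T' : measurableType dT'}
    (Z Z' : {RV P >-> T'}) : Prop :=
  forall A, measurable A -> distribution P Z A = distribution P Z' A.

(* The sigma-algebras generated by x_0, xi_0, xi_1, ..., xi~_0, xi~_1, ... *)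
Definition sample_sigma {d1 d2} {T1 : measurableType d1}
    {T2 : measurableType d2} (x0 : T -> T1) (xi xit : nat -> T -> T2)
    (i : option (nat + nat)) : set (set T) :=
  match i with
  | None => sigma_rv x0
  | Some (inl k) => sigma_rv (xi k)
  | Some (inr k) => sigma_rv (xit k)
  end.

End Probability.

(* Main.v *)
From HB Require Import structures.
Require Import Defs.
From mathcomp Require Import all_boot all_order all_algebra.
From mathcomp Require Import all_classical all_reals all_analysis.
From mathcomp Require Import measurable_realfun ring lra.

Set Implicit Arguments.
Unset Strict Implicit.
Unset Printing Implicit Defensive.

Import Order.TTheory GRing.Theory Num.Theory numFieldNormedType.Exports.

Local Open Scope classical_set_scope.
Local Open Scope ring_scope.

(** One mirror-prox step satisfies, for every [z] in [X],
      [gamma <v, y - z> <= D(x, z) - D(x', z) + gamma^2 |v - u|^2 / (2 mu)],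
    where [u], [v] are the two oracle answers and [x'] is the next iterate. The
    remaining term [<Delta, y - z>], with [Delta = v - F y] the noise at [y], cannot
    be averaged directly since [z] depends on the sample path. It is split as
    [<Delta, y - a> + <Delta, a - z>], where [a] is an auxiliary mirror descent
    sequence driven by [-Delta]: the first part is a martingale difference, and the
    second is again controlled by a telescoping Bregman distance. Multiplying by the
    nondecreasing weights [gamma_k^(r-1)] and summing by parts bounds the gap of the
    average by a quantity that no longer involves [z] and whose expectation is
    computed from independence and Fubini. *)

(** * Sums of powers *)

Section PowerSums.
Context {R : realType}.
Implicit Types (a b c h x s t : R) (K : nat).

(** Every quantity under an expectation has to be measurable, yet the prox map is a choice of
    minimizer, [F] is given only as a pointwise expectation, and the oracle is controlled on [X]
    alone. Strong convexity settles the first point (the minimizer is a Lipschitz function of one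
    dual variable), partial integration the second, extension by 0 the third. Independence is used
    without conditional expectations: each iterate carries the set of samples that it uses, and
    neither [a_k] nor [y_(k+1)] uses [xi_k]. The price of the auxiliary sequence is a second Bregman
    distance and one more squared noise term. For stepsizes gamma_0 / sqrt(k+1) both sums become S_a
    = sum of (k+1)^(a-1), with a = s = 1 - r/2 or a = t = s - 1/2, and the rate splits into K^s <= 2
    s 2^s S_s (distances) and t sqrt(K) S_t <= s 2^s S_s (squared errors). Explicit constants are
    required, not asymptotics; hence the Bernoulli inequalities and the case analysis below. *)

Lemma powR_bernoulli_le a x : 0 < a <= 1 -> -1 <= x -> (1 + x) `^ a <= 1 + a * x.
Proof.
(* At [x = -1] the base is 0, out of reach of the logarithm used below. *)
move=> /andP[a0 a1]; rewrite le_eqVlt => /predU1P[<-|x1].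
  by rewrite subrr powR0 ?gt_eqF// mulrN1 subr_ge0.
have x0 : 0 < 1 + x by lra.
have h : 0 < 1 + a * x by nra.
rewrite -ler_ln ?posrE ?powR_gt0// ln_powR.
have := @concave_ln R (Itv01 (ltW a0) a1) (1 + x) 1 x0 ltr01.
rewrite !convRE /= ln1 mulr0 addr0 => /le_trans; apply.
by rewrite ler_ln ?posrE//; [|move: h]; rewrite /unstable.onem; lra.
Qed.

(** Inverse form of the concave case: apply it with exponent [a^-1] to [a * x], then raise to the
    power [a]. *)
Lemma powR_bernoulli_ge a x : 1 <= a -> -1 <= x -> 1 + a * x <= (1 + x) `^ a.
Proof.
move=> a1 x1; have a0 : 0 < a by lra.
have [h|h] := leP 0 (1 + a * x); last by rewrite (le_trans (ltW h))// powR_ge0.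
have ia : 0 < a^-1 <= 1 by rewrite invr_gt0 a0 invf_le1.
have ax : -1 <= a * x by lra.
have := powR_bernoulli_le ia ax; rewrite mulKf ?gt_eqF// => k.
have -> : 1 + a * x = ((1 + a * x) `^ a^-1) `^ a.
  by rewrite -powRrM mulVf ?gt_eqF// powRr1.
by apply: ge0_ler_powR; rewrite ?nnegrE ?powR_ge0 ?(ltW a0)//; lra.
Qed.

Let powR_factor a c h : 0 < c -> - c <= h ->
  (c + h) `^ a = c `^ a * (1 + h / c) `^ a.
Proof.
move=> c0 ch; have hc : 0 <= 1 + h / c.
  by rewrite addrC -lerBlDr sub0r ler_pdivlMr// mulN1r.
rewrite -powRM ?(ltW c0)//.
by rewrite mulrDr mulr1 mulrCA divff ?gt_eqF// mulr1.
Qed.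

Let powR_tangentE a c h : 0 < c ->
  c `^ a + a * h * c `^ (a - 1) = c `^ a * (1 + a * (h / c)).
Proof.
move=> c0; rewrite powRB ?(gt_eqF c0) ?implybT// powRr1 ?ltW//.
by field; rewrite gt_eqF.
Qed.

(** A concave power lies below its tangent at [c]. Taken with [h = 1] and [h = -1] at integers and
    summed, this replaces the comparison of a sum with an integral. *)
Lemma powR_tangent_le a c h : 0 < a <= 1 -> 0 < c -> - c <= h ->
  (c + h) `^ a <= c `^ a + a * h * c `^ (a - 1).
Proof.
move=> a01 c0 ch; rewrite powR_factor// powR_tangentE// ler_pM2l ?powR_gt0//.
by apply: powR_bernoulli_le => //; rewrite ler_pdivlMr// mulN1r.
Qed.

Lemma powR_tangent_ge a c h : 1 <= a -> 0 < c -> - c <= h ->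
  c `^ a + a * h * c `^ (a - 1) <= (c + h) `^ a.
Proof.
move=> a01 c0 ch; rewrite powR_factor// powR_tangentE// ler_pM2l ?powR_gt0//.
by apply: powR_bernoulli_ge => //; rewrite ler_pdivlMr// mulN1r.
Qed.

(** The discrete counterpart of K^a / a; the shift of the exponent lets the bounds compare
    [a * powsum a K] with a power of exponent [a]. *)
Definition powsum a K : R := \sum_(k < K) k.+1%:R `^ (a - 1).

Lemma powsumS a K : powsum a K.+1 = powsum a K + K.+1%:R `^ (a - 1).
Proof. by rewrite /powsum big_ord_recr. Qed.

Lemma powsum_ge0 a K : 0 <= powsum a K.
Proof. by apply: sumr_ge0 => i _; exact: powR_ge0. Qed.

Let natS K : (K.+1%:R : R) + -1 = K%:R.
Proof. by rewrite -natr1 addrK. Qed.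

Let Nnat_le K : - (K.+1%:R : R) <= -1.
Proof. by rewrite lerN2 ler1n. Qed.

Lemma powsum_le_powR a K : 0 < a <= 1 -> a * powsum a K <= K%:R `^ a.
Proof.
move=> a01; elim: K => [|K IH].
  by rewrite /powsum big_ord0 mulr0 powR_ge0.
have := @powR_tangent_le a K.+1%:R (-1) a01 (ltr0Sn _ _) (Nnat_le _).
rewrite natS powsumS => h; lra.
Qed.

(** Starting the induction at [K = 1], where the sum is exactly 1, gains [1 - a]. This gain is
    decisive for small [a] and small [K]. *)
Lemma powsum_le_powR1 a K : 0 < a <= 1 -> (0 < K)%N ->
  a * powsum a K <= K%:R `^ a - 1 + a.
Proof.
move=> a01; case: K => // K _; elim: K => [|K IH].
  by rewrite /powsum big_ord_recr big_ord0 /= !powR1; lra.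
have := @powR_tangent_le a K.+2%:R (-1) a01 (ltr0Sn _ _) (Nnat_le _).
rewrite natS powsumS => h; lra.
Qed.

Lemma powsum_ge_powR a K : 1 <= a -> K%:R `^ a <= a * powsum a K.
Proof.
move=> a1; elim: K => [|K IH].
  by rewrite /powsum big_ord0 mulr0 powR0//; lra.
have := @powR_tangent_ge a K.+1%:R (-1) a1 (ltr0Sn _ _) (Nnat_le _).
rewrite natS powsumS => h; lra.
Qed.

Lemma powsum_ge_powRS a K : 0 < a <= 1 -> K.+1%:R `^ a - 1 <= a * powsum a K.
Proof.
move=> a01; elim: K => [|K IH].
  by rewrite /powsum big_ord0 powR1; lra.
have c1 : - (K.+1%:R : R) <= 1 by rewrite (le_trans (Nnat_le _))//; lra.
have := @powR_tangent_le a K.+1%:R 1 a01 (ltr0Sn _ _) c1.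
rewrite natr1 powsumS => h; lra.
Qed.

Lemma powsum_le_powRS a K : 1 <= a -> a * powsum a K <= K.+1%:R `^ a - 1.
Proof.
move=> a1; elim: K => [|K IH].
  by rewrite /powsum big_ord0 powR1; lra.
have c1 : - (K.+1%:R : R) <= 1 by rewrite (le_trans (Nnat_le _))//; lra.
have := @powR_tangent_ge a K.+1%:R 1 a1 (ltr0Sn _ _) c1.
rewrite natr1 powsumS => h; lra.
Qed.

(** The summands decrease, so each is at least the last one. The estimate is off by a factor [a] for
    large [K] but has no additive loss, which makes it the right one for small [K]. *)
Lemma powR_le_powsum a K : 0 < a <= 1 -> K%:R `^ a <= powsum a K.
Proof.
move=> a01; have [->|K0] := posnP K; first by rewrite powR0 ?powsum_ge0//; lra.
have -> : (K%:R : R) `^ a = \sum_(k < K) K%:R `^ (a - 1).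
  rewrite sumr_const card_ord -[RHS]mulr_natl mulr_powRB1//.
  by move: a01 => /andP[].
apply: ler_sum => k _.
rewrite -[a - 1]opprB !powRN lef_pV2 ?posrE ?powR_gt0 ?ltr0n//.
by apply: ge0_ler_powR; rewrite ?nnegrE ?ler0n ?ler_nat//; lra.
Qed.

Lemma powR2_ge7_5 s : 1 / 2 <= s -> 7 / 5 <= (2 : R) `^ s.
Proof.
move=> s1; apply: (@le_trans _ _ (2 `^ 2^-1)); last by apply: ler_powR; lra.
rewrite powR12_sqrt// (_ : 7 / 5 = Num.sqrt ((7 / 5) ^+ 2)); last first.
  by rewrite sqrtr_sqr ger0_norm//; lra.
by rewrite ler_wsqrtr//; lra.
Qed.

Lemma powsum_lower s K : 1 / 2 <= s -> K%:R `^ s <= 2 * s * 2 `^ s * powsum s K.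
Proof.
move=> s2; have h2 := powR2_ge7_5 s2; have S0 := powsum_ge0 s K.
have p0 : 0 <= s * powsum s K by rewrite mulr_ge0//; lra.
have [s1|s1] := leP s 1.
  have s01 : 0 < s <= 1 by rewrite s1 andbT; lra.
  have := powR_le_powsum K s01 => h; nra.
have := powsum_ge_powR K (ltW s1) => h; nra.
Qed.

Lemma sqrt_powR t K : (0 < K)%N -> Num.sqrt (K%:R : R) * K%:R `^ t = K%:R `^ (t + 1 / 2).
Proof.
move=> K0; rewrite powRD ?pnatr_eq0 -?lt0n ?K0 ?implybT// mulrC div1r powR12_sqrt//.
Qed.

(** This half controls the squared oracle errors. Heuristically t S_t is K^t and s S_s is K^s with s
    = t + 1/2, so both sides agree up to the spare factor 2^s, which has to absorb all
    discretization losses. For s > 1 the lower bound K^s <= s S_s is lossless; for s <= 1 either an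
    additive 1 or a factor s is lost, depending on the bound chosen. *)
Lemma powsum_ratio t K : 0 < t -> (3 < K)%N ->
  t * Num.sqrt K%:R * powsum t K <=
    (t + 1 / 2) * 2 `^ (t + 1 / 2) * powsum (t + 1 / 2) K.
Proof.
move=> t0 K3; have K0 : (0 < K)%N by apply: leq_trans K3.
set s := t + 1 / 2; have s2 : 1 / 2 <= s by rewrite /s; lra.
have h2 := powR2_ge7_5 s2; have sq0 := sqrtr_ge0 (K%:R : R).
have KE := sqrt_powR t K0; rewrite -/s in KE.
have S0 := powsum_ge0 s K; have T0 := powsum_ge0 t K.
rewrite -mulrA mulrCA.
have [t2|t2] := leP t (1 / 2); last first.
  have s1 : 1 <= s by rewrite /s; lra.
  have hS := powsum_ge_powR K s1.
  have [t1|t1] := leP t 1.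
    have t01 : 0 < t <= 1 by rewrite t1 t0.
    have hT := powsum_le_powR K t01.
    apply: (@le_trans _ _ (K%:R `^ s)); first by rewrite -KE ler_wpM2l.
    by rewrite (le_trans hS)// mulrAC ler_peMr ?mulr_ge0//; lra.
  have hT := powsum_le_powRS K (ltW t1).
  (* Since [t > 1], the upper bound on the sum involves K+1; here K+1 <= 2K spends the spare
     factor. *)
  have hK : K.+1%:R `^ t <= 2 `^ s * K%:R `^ t.
    apply: (@le_trans _ _ (2 `^ t * K%:R `^ t)); last first.
      by rewrite ler_wpM2r ?powR_ge0// ler_powR ?ler1n// /s; lra.
    rewrite -powRM ?ler0n//; apply: ge0_ler_powR; rewrite ?nnegrE//.
    - exact: ltW.
    - by rewrite -natrM ler_nat mul2n -addnn -addn1 leq_add2l.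
  apply: (@le_trans _ _ (2 `^ s * K%:R `^ s)); last first.
    by rewrite [s * _]mulrC -mulrA ler_wpM2l ?powR_ge0.
  by rewrite -KE [leRHS]mulrCA ler_wpM2l//; lra.
have s01 : 0 < s <= 1 by rewrite /s; lra.
have t01 : 0 < t <= 1 by rewrite t0; lra.
have hT := powsum_le_powR1 t01 K0.
have hT' := powsum_le_powR K t01.
(* Beyond 16 one has K^s >= 16^(1/2) = 4, and (7/5)(K^s - 1) >= K^s as soon as K^s >= 7/2. Up to 16
   the bound without additive loss is used instead. *)
have [K16|K16] := leqP K 16.
  have hS := powR_le_powsum K s01.
  have Kt1 : 1 <= (K%:R : R) `^ t.
    rewrite -[leLHS](powRr0 (K%:R : R)).
    by apply: ler_powR; [rewrite ler1n|exact: ltW].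
  suff h : t * powsum t K <= s * 2 `^ s * K%:R `^ t.
    apply: (@le_trans _ _ (s * 2 `^ s * K%:R `^ s)); last first.
      by rewrite ler_wpM2l// mulr_ge0 ?powR_ge0//; lra.
    by rewrite -KE [leRHS]mulrCA ler_wpM2l.
  (* For t >= 1/4, s 2^s >= (3/4)(7/5) > 1. For t < 1/4 only s 2^s >= 7/10 is available, but K^t <=
     16^(1/4) = 2 makes the gain 1 - t outweigh the missing 3/10 of K^t. *)
  have [t4|t4] := leP (1 / 4) t.
    have : 1 <= s * 2 `^ s by rewrite /s in h2 *; nra.
    nra.
  have : (K%:R : R) `^ t <= 2.
    apply: (@le_trans _ _ ((2 ^+ 4) `^ t)).
      apply: ge0_ler_powR; rewrite ?nnegrE ?(ltW t0)//.
      by rewrite -natrX ler_nat.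
    rewrite -powR_mulrn// -powRrM -[leRHS]powRr1//; apply: ler_powR; lra.
  have : 7 / 10 <= s * 2 `^ s by nra.
  nra.
have hS := powsum_ge_powRS K s01.
apply: (@le_trans _ _ (K%:R `^ s)); first by rewrite -KE ler_wpM2l.
suff : K%:R `^ s <= 2 `^ s * (K.+1%:R `^ s - 1) by nra.
have hK : (K%:R : R) `^ s <= K.+1%:R `^ s.
  by apply: ge0_ler_powR; rewrite ?nnegrE ?ler_nat//; lra.
have K4 : 4 <= (K%:R : R) `^ s.
  apply: (@le_trans _ _ ((2 ^+ 4) `^ s)).
    rewrite -powR_mulrn// -powRrM (@le_trans _ _ (2 `^ 2%:R))//.
      by rewrite powR_mulrn//; lra.
    by apply: ler_powR; lra.
  by apply: ge0_ler_powR; rewrite ?nnegrE -?natrX ?ler_nat//; [lra|exact: ltnW].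
nra.
Qed.
End PowerSums.

(** * Norms and prox mappings *)

Section Dot.
Context {R : realType} {n : nat}.
Implicit Types (u v w : 'rV[R]_n) (a : R).

Lemma dotC u v : dot u v = dot v u.
Proof. by apply: eq_bigr => j _; rewrite mulrC. Qed.

Lemma dotDl u v w : dot (u + v) w = dot u w + dot v w.
Proof. by rewrite /dot -big_split; apply: eq_bigr => j _; rewrite mxE mulrDl. Qed.

Lemma dotZl a u v : dot (a *: u) v = a * dot u v.
Proof. by rewrite /dot mulr_sumr; apply: eq_bigr => j _; rewrite mxE mulrA. Qed.

Lemma dotDr u v w : dot u (v + w) = dot u v + dot u w.
Proof. by rewrite dotC dotDl !(dotC u). Qed.

Lemma dotZr a u v : dot u (a *: v) = a * dot u v.
Proof. by rewrite dotC dotZl dotC. Qed.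

Lemma dotNl u v : dot (- u) v = - dot u v.
Proof. by rewrite -scaleN1r dotZl mulN1r. Qed.

Lemma dotNr u v : dot u (- v) = - dot u v.
Proof. by rewrite -scaleN1r dotZr mulN1r. Qed.

Lemma dotBl u v w : dot (u - v) w = dot u w - dot v w.
Proof. by rewrite dotDl dotNl. Qed.

Lemma dotBr u v w : dot u (v - w) = dot u v - dot u w.
Proof. by rewrite dotDr dotNr. Qed.

Lemma dot0l v : dot 0 v = 0.
Proof. by rewrite -(scale0r 0) dotZl mul0r. Qed.

Lemma dot0r v : dot v 0 = 0.
Proof. by rewrite dotC dot0l. Qed.

Lemma dot_sumr (I : Type) (s : seq I) u (v : I -> 'rV[R]_n) :
  dot u (\sum_(i <- s) v i) = \sum_(i <- s) dot u (v i).
Proof.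
rewrite /dot exchange_big; apply: eq_bigr => j _.
by rewrite summxE mulr_sumr.
Qed.

Lemma coord_le_norm u j : `|u 0 j| <= `|u|.
Proof.
rewrite [leRHS]/Num.norm/= mx_normrE.
by apply: (@le_bigmax_cond _ _ _ _ (0, j) xpredT (fun ij => `|u ij.1 ij.2|)).
Qed.

Lemma norm_dot_le u v : `|dot u v| <= n%:R * `|u| * `|v|.
Proof.
rewrite (le_trans (ler_norm_sum _ _ _))//.
have -> : n%:R * `|u| * `|v| = \sum_(j < n) `|u| * `|v|.
  by rewrite sumr_const card_ord -[RHS]mulr_natl mulrA.
apply: ler_sum => j _.
by rewrite normrM ler_pM// coord_le_norm.
Qed.

Lemma dot_eq0 u : dot u u <= 0 -> u = 0.
Proof.
move=> u0; apply/rowP => j; rewrite mxE; apply/eqP; rewrite -[_ == 0]sqrf_eq0 eq_le.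
rewrite sqr_ge0 andbT (le_trans _ u0)// expr2 /dot (bigD1 j)//= lerDl.
by apply: sumr_ge0 => i _; rewrite -expr2 sqr_ge0.
Qed.

End Dot.

Section NormTheory.
Context {R : realType} {n : nat}.
Variable N : 'rV[R]_n -> R.
Hypothesis N_norm : is_norm N.
Implicit Types (x y : 'rV[R]_n) (a : R).

Lemma is_normZ a x : N (a *: x) = `|a| * N x.
Proof. by case: N_norm. Qed.

Lemma is_normD x y : N (x + y) <= N x + N y.
Proof. by case: N_norm. Qed.

Lemma is_norm0 : N 0 = 0.
Proof. by rewrite -(scale0r 0) is_normZ normr0 mul0r. Qed.

Lemma is_normN x : N (- x) = N x.
Proof. by rewrite -scaleN1r is_normZ normrN1 mul1r. Qed.

Lemma is_norm_ge0 x : 0 <= N x.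
Proof.
have := is_normD x (- x); rewrite subrr is_norm0 is_normN; lra.
Qed.

Lemma is_normB x y : N (x - y) <= N x + N y.
Proof. by rewrite -(is_normN y) is_normD. Qed.

Lemma is_norm_sum (I : Type) (s : seq I) (f : I -> 'rV[R]_n) :
  N (\sum_(i <- s) f i) <= \sum_(i <- s) N (f i).
Proof.
elim/big_ind2 : _ => [|a x b y ha hb|//]; first by rewrite is_norm0.
by rewrite (le_trans (is_normD _ _))// lerD.
Qed.

Lemma is_norm_le_norm : exists2 M, 0 < M & forall x, N x <= M * `|x|.
Proof.
exists (1 + \sum_(j < n) N (delta_mx 0 j)).
  by rewrite ltr_wpDr// sumr_ge0// => j _; exact: is_norm_ge0.
move=> x; rewrite {1}(row_sum_delta x) (le_trans (is_norm_sum _ _))//.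
rewrite mulrDl mul1r ler_wpDl// mulr_suml; apply: ler_sum => j _.
by rewrite is_normZ mulrC ler_wpM2l ?is_norm_ge0// coord_le_norm.
Qed.

Lemma is_norm_dist x y : `|N x - N y| <= N (x - y).
Proof.
have := is_normD (x - y) y; rewrite subrK.
have := is_normD (y - x) x; rewrite subrK -opprB is_normN => h1 h2.
by rewrite ler_norml; apply/andP; split; lra.
Qed.

Lemma is_norm_continuous : continuous N.
Proof.
have [M M0 NM] := is_norm_le_norm.
move=> x; apply/(@cvgrPdist_le _ _ _ (nbhs x) (nbhs_filter x) N) => e e0; apply/nbhs_ballP.
exists (e / M); first by rewrite /= divr_gt0.
move=> y; rewrite -ball_normE /= => xy.
rewrite (le_trans (is_norm_dist _ _))// (le_trans (NM _))// mulrC -ler_pdivlMr//.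
exact: ltW.
Qed.

(** Equivalence of norms: [N] attains a positive minimum on the compact unit sphere of the max
    norm. *)
Lemma norm_le_is_norm : exists2 M, 0 < M & forall x, `|x| <= M * N x.
Proof.
pose S := [set x : 'rV[R]_n | `|x| = 1].
(* An empty sphere means that every vector is 0 (dimension 0), and any constant works. *)
have [S0|/set0P/negP/negPn/eqP S0] := pselect (S !=set0); last first.
  exists 1 => // x; rewrite mul1r; have [->|x0] := eqVneq x 0.
    by rewrite normr0 is_norm_ge0.
  have : S (`|x|^-1 *: x).
    by rewrite /S/= normrZ normfV normr_id mulVf// normr_eq0.
  by rewrite S0.
have cS : compact S.
  apply: bounded_closed_compact.
    exists 1; split; first exact: num_real.
    by move=> M M1 x /= ->; exact: ltW.
  rewrite (_ : S = (fun x => `|x|) @^-1` [set 1]); last by [].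
  apply: closed_comp; last exact: closed_eq.
  by move=> x _; exact: norm_continuous.
have cN : {within S, continuous N}.
  by apply: continuous_subspaceT => x; exact: is_norm_continuous.
have [c /set_mem Sc cmin] := EVT_min_rV S0 cS cN.
have Nc : 0 < N c.
  rewrite lt_neqAle is_norm_ge0 andbT eq_sym; apply/eqP => Nc0.
  have c0 : c = 0 by case: N_norm => + _ _; apply.
  by move: Sc; rewrite /S/= c0 normr0 => /esym/eqP; rewrite oner_eq0.
exists (N c)^-1; first by rewrite invr_gt0.
move=> x; have [->|x0] := eqVneq x 0.
  by rewrite normr0 mulr_ge0 ?is_norm_ge0// invr_ge0 ltW.
have nx : 0 < `|x| by rewrite normr_gt0.
have : N c <= N (`|x|^-1 *: x).
  apply: cmin; apply/mem_set.
  by rewrite /S/= normrZ normfV normr_id mulVf// normr_eq0.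
rewrite is_normZ normfV normr_id => h.
by rewrite mulrC ler_pdivlMr// mulrC -ler_pdivlMr// mulrC.
Qed.

Local Notation Nd := (dual_norm N).

Let dualset x := [set dot y x | y in [set y | N y <= 1]].

Let dualset0 x : dualset x 0.
Proof. by exists 0; rewrite ?dot0l//= is_norm0. Qed.

(** A real [sup] carries information only for nonempty bounded sets; equivalence of norms supplies
    the bound. *)
Let dualset_sup x : has_sup (dualset x).
Proof.
split; first by exists 0; exact: dualset0.
have [M M0 NM] := norm_le_is_norm.
exists (n%:R * M * `|x|) => _ [y /= Ny <-].
rewrite (le_trans (ler_norm _))// (le_trans (norm_dot_le _ _))//.
by rewrite ler_wpM2r// ler_wpM2l// (le_trans (NM _))// ler_piMr// ltW.
Qed.

Lemma dual_norm_ge0 x : 0 <= Nd x.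
Proof. exact: (sup_upper_bound (dualset_sup x) (dualset0 x)). Qed.

Lemma dot_le_dual_norm y x : dot y x <= N y * Nd x.
Proof.
have [Ny|Ny] := eqVneq (N y) 0.
  have -> : y = 0 by case: N_norm => + _ _; apply.
  by rewrite dot0l is_norm0 mul0r.
have Ny0 : 0 < N y by rewrite lt_neqAle eq_sym Ny is_norm_ge0.
rewrite -ler_pdivrMl// -dotZl; apply: (sup_upper_bound (dualset_sup x)).
exists ((N y)^-1 *: y) => //=.
by rewrite is_normZ ger0_norm ?invr_ge0 ?is_norm_ge0// mulVf.
Qed.

Lemma norm_dot_le_dual_norm y x : `|dot y x| <= N y * Nd x.
Proof.
rewrite ler_norml dot_le_dual_norm andbT lerNl -dotNl.
by rewrite (le_trans (dot_le_dual_norm _ _))// is_normN.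
Qed.

Lemma dual_norm_le x b : (forall y, N y <= 1 -> dot y x <= b) -> Nd x <= b.
Proof.
move=> h; apply: ge_sup; first by exists 0; exact: dualset0.
by move=> _ [y /= Ny <-]; exact: h.
Qed.

Lemma dual_norm_is_norm : is_norm Nd.
Proof.
have Zle a x : Nd (a *: x) <= `|a| * Nd x.
  apply: dual_norm_le => y Ny; rewrite dotZr (le_trans (ler_norm _))// normrM.
  rewrite ler_wpM2l// (le_trans (norm_dot_le_dual_norm _ _))//.
  by rewrite ler_piMl// dual_norm_ge0.
split.
- move=> x Nx0; apply: dot_eq0.
  by rewrite (le_trans (dot_le_dual_norm _ _))// Nx0 mulr0.
- move=> a x; apply/eqP; rewrite eq_le Zle/=.
  have [->|a0] := eqVneq a 0; first by rewrite normr0 mul0r dual_norm_ge0.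
  rewrite -[x in leLHS](scalerK a0) (le_trans (ler_wpM2l _ (Zle _ _)))//.
  by rewrite mulrA normfV mulfV ?normr_eq0// mul1r.
- move=> x y; apply: dual_norm_le => z Nz; rewrite dotDr; apply: lerD.
  + by rewrite (le_trans (dot_le_dual_norm _ _))// ler_piMl// dual_norm_ge0.
  + by rewrite (le_trans (dot_le_dual_norm _ _))// ler_piMl// dual_norm_ge0.
Qed.

End NormTheory.

(** * Prox steps on a single block *)

Section Prox.
Context {R : realType} {n : nat}.
Variables (N : 'rV[R]_n -> R) (A : set 'rV[R]_n).
Variables (f : 'rV[R]_n -> R) (g : 'rV[R]_n -> 'rV[R]_n) (mu L B : R).
Hypotheses (N_norm : is_norm N) (A_neq0 : A !=set0) (A_closed : closed A)
  (A_convex : convex_set A) (A_bounded : forall x, A x -> N x <= B).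
Hypotheses (f_C1 : C1_on A f g) (mu_gt0 : 0 < mu) (L_ge0 : 0 <= L).
Hypothesis f_strong : forall x y, A x -> A y ->
  f x + dot (g x) (y - x) + mu / 2 * N (x - y) ^+ 2 <= f y.
Hypothesis f_smooth : forall x y, A x -> A y ->
  f y <= f x + dot (g x) (y - x) + L / 2 * N (x - y) ^+ 2.

Local Notation Nd := (dual_norm N).
Local Notation D := (bregman f g).
Implicit Types (x y z w p q u v : 'rV[R]_n) (t : R).

(** Up to terms constant in z, the prox objective is <y - g x, z> + f z, so prox depends on the
    single dual vector y - g x. In convex analysis this is the gradient at -p of the conjugate of f
    restricted to A. *)
Definition mirror_map p := xget 0 (argmin A (fun z => dot p z + f z)).

Lemma proxE x y : prox A f g x y = mirror_map (y - g x).
Proof.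
congr xget; apply/seteqP; split => z /= [Az zmin]; split => // z' Az';
  have := zmin z' Az'; rewrite /bregman !dotBl !dotBr; lra.
Qed.

Lemma C1_on_continuous : {within A, continuous f}.
Proof.
have [_ df] := f_C1.
apply/subspace_continuousP => x Ax.
pose c := n%:R * `|g x| + 1.
have c0 : 0 < c by rewrite ltr_wpDl// mulr_ge0.
apply/(@cvgrPdist_le _ _ _ (within A (nbhs x))) => e e0.
have near_x : nbhs x [set y | `|x - y| <= e / c].
  apply/nbhs_ballP; exists (e / c); first by rewrite /= divr_gt0.
  by move=> y; rewrite -ball_normE /= => /ltW.
have near_f : nbhs x [set y | A y ->
    `|f y - f x - dot (g x) (y - x)| <= 1 * `|y - x|] := df x Ax 1 ltr01.
suff : nbhs x [set y | A y -> `|f x - f y| <= e] by [].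
apply: (@filterS _ (nbhs x) (nbhs_filter x) _ _ _
  (@filterI _ _ (nbhs_filter x) _ _ near_x near_f)).
move=> y [/= xy] /[apply] fy.
rewrite ler_pdivlMr// mulrC in xy; apply: le_trans xy.
rewrite distrC -(subrK (dot (g x) (y - x)) (f y - f x)).
rewrite (le_trans (ler_normD _ _))// /c mulrDl [leRHS]addrC (distrC x y).
by rewrite lerD// norm_dot_le.
Qed.

Lemma bounded_set_compact : compact A.
Proof.
have [M M0 NM] := norm_le_is_norm N_norm.
apply: bounded_closed_compact => //.
exists (M * B); split; first exact: num_real.
move=> b Mb x Ax; apply: (le_trans (NM _)); apply: le_trans (ltW Mb).
by rewrite ler_pM2l// A_bounded.
Qed.

(** By compactness of [A] the minimum is attained, so [xget] never falls back on its default. *)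
Lemma mirror_map_argmin p : argmin A (fun z => dot p z + f z) (mirror_map p).
Proof.
have cf : {within A, continuous (fun z => dot p z + f z)}.
  move=> x; apply: (@continuousD _ _ _ (dot p : subspace A -> R) f).
    apply: continuous_subspaceT => {}x.
    apply/(@cvgrPdist_le _ _ _ (nbhs x)) => e e0; apply/nbhs_ballP.
    have c0 : 0 < n%:R * `|p| + 1 by rewrite ltr_wpDl// mulr_ge0.
    exists (e / (n%:R * `|p| + 1)); first by rewrite /= divr_gt0.
    move=> y; rewrite -ball_normE /= => /ltW; rewrite ler_pdivlMr// mulrC => h.
    rewrite -dotBr (le_trans (norm_dot_le _ _))// (le_trans _ h)// ler_wpM2r//.
    by rewrite lerDl.
  exact: C1_on_continuous.
have [c Ac cmin] := EVT_min_rV A_neq0 bounded_set_compact cf.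
rewrite /mirror_map; apply: (@xgetI _ 0 _ c); split; first exact: set_mem.
by move=> z Az; apply: cmin; exact: mem_set.
Qed.

Lemma mirror_map_in p : A (mirror_map p).
Proof. by have [] := mirror_map_argmin p. Qed.

Lemma mirror_map_min p z : A z -> dot p (mirror_map p) + f (mirror_map p) <= dot p z + f z.
Proof. by have [_] := mirror_map_argmin p; apply. Qed.

Lemma convex_segment x y t : A x -> A y -> 0 <= t <= 1 -> A (x + t *: (y - x)).
Proof.
move=> Ax Ay /andP[t0 t1].
have /set_mem := A_convex (Itv01 t0 t1) (mem_set Ay) (mem_set Ax).
congr A; rewrite /conv/= /unstable.onem scalerBl scale1r scalerBr.
by rewrite addrC addrAC addrA.
Qed.

(** The quadratic upper bound on f replaces differentiation along the segment: comparing the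
    minimizer z with z + t (w - z) gives 0 <= t a + t^2 b, where a is the inner product in question,
    and a < 0 is refuted by one explicit t. *)
Lemma mirror_map_optimal p w : A w -> 0 <= dot (p + g (mirror_map p)) (w - mirror_map p).
Proof.
move=> Aw; set z : 'rV[R]_n := mirror_map p; have Az : A z := mirror_map_in p.
rewrite leNgt; apply/negP; set a := dot _ _ => a0.
pose b := L / 2 * N (z - w) ^+ 2.
have b0 : 0 <= b by rewrite mulr_ge0 ?sqr_ge0// divr_ge0.
(* Any t in (0, 1] with t b < -a would do. This one is well defined even for b = 0 and gives (a + t
   b)(b - a) = -a^2. *)
pose t : R := - a / (- a + b).
have ab : 0 < - a + b by lra.
have t0 : 0 < t by rewrite divr_gt0//; lra.
have t1 : t <= 1 by rewrite ler_pdivrMr//; lra.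
have Awt : A (z + t *: (w - z)) by apply: convex_segment => //; rewrite t1 ltW.
have h1 := mirror_map_min p Awt.
have h2 := f_smooth Az Awt.
rewrite -/z in h1.
have e1 : z + t *: (w - z) - z = t *: (w - z) by rewrite addrAC subrr add0r.
have e2 : z - (z + t *: (w - z)) = t *: (z - w).
  by rewrite opprD addrA subrr add0r -scalerN opprB.
rewrite e1 e2 (is_normZ N_norm) in h2. rewrite exprMn ger0_norm ?(ltW t0)// in h2.
have ha : a = dot p (w - z) + dot (g z) (w - z) by rewrite /a dotDl.
rewrite dotZr in h2; rewrite dotDr dotZr in h1.
have h3 : 0 <= t * a + t ^+ 2 * b by rewrite /b ha; lra.
have h4 : 0 <= a + t * b by rewrite -(pmulr_rge0 _ t0) mulrDr mulrA -expr2.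
have : (a + t * b) * (- a + b) < 0.
  have -> : (a + t * b) * (- a + b) = - a ^+ 2.
    by rewrite /t; field; rewrite gt_eqF.
  by rewrite oppr_lt0 exprn_even_gt0//= lt_eqF.
by rewrite ltNge mulr_ge0// ltW.
Qed.

Lemma bregman_ge x y : A x -> A y -> mu / 2 * N (x - y) ^+ 2 <= D x y.
Proof. by move=> Ax Ay; have := f_strong Ax Ay; rewrite /bregman; lra. Qed.

Lemma bregman_ge0 x y : A x -> A y -> 0 <= D x y.
Proof.
move=> Ax Ay; apply: le_trans (bregman_ge Ax Ay).
by rewrite mulr_ge0 ?sqr_ge0// divr_ge0// ltW.
Qed.

(** The diameter of [A] is at most 2 B, so the smoothness bound is (L / 2)(2 B)^2. Two such
    distances produce the constant 4 of the theorem. *)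
Lemma bregman_le x y : A x -> A y -> D x y <= 2 * L * B ^+ 2.
Proof.
move=> Ax Ay; have h := f_smooth Ax Ay.
have h2 : N (x - y) <= 2 * B.
  have := is_normB N_norm x y; have := A_bounded Ax; have := A_bounded Ay; lra.
have h3 : N (x - y) ^+ 2 <= (2 * B) ^+ 2.
  by rewrite ler_sqr ?nnegrE ?is_norm_ge0//; apply: le_trans h2; rewrite is_norm_ge0.
have : L / 2 * N (x - y) ^+ 2 <= L / 2 * (2 * B) ^+ 2.
  by rewrite ler_wpM2l// divr_ge0.
rewrite /bregman; lra.
Qed.

(** Test the optimality of each minimizer at the other and add: the two strong convexity
    inequalities make the gradient strongly monotone, leaving mu N(z - z')^2 <= <p - q, z' - z>. *)
Lemma mirror_map_lipschitz p q : mu * N (mirror_map p - mirror_map q) <= Nd (p - q).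
Proof.
have hp := mirror_map_optimal p (mirror_map_in q); have hq := mirror_map_optimal q (mirror_map_in p).
have := mirror_map_in p; have := mirror_map_in q.
set z := mirror_map p in hp hq *; set z' := mirror_map q in hp hq * => Az' Az.
have h1 := f_strong Az Az'; have h2 := f_strong Az' Az.
have e : N (z' - z) = N (z - z') by rewrite -is_normN// opprB.
have := dot_le_dual_norm N_norm (z' - z) (p - q).
rewrite dotC e; set c := N (z - z') in h1 h2 *; rewrite -/c => h3.
have [->|c0] := eqVneq c 0; first by rewrite mulr0 dual_norm_ge0.
have c1 : 0 < c by rewrite lt_neqAle eq_sym c0 is_norm_ge0.
rewrite -(ler_pM2l c1).
move: h1 h2 hp hq h3; rewrite e -/c !(dotDl, dotDr, dotNl, dotNr) => *.
nra.
Qed.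

(** First-order optimality of z, rewritten with the identity <g z - g x, w - z> = D x w - D z w - D
    x z. *)
Lemma prox_three_point x p w : A x -> A w ->
  let z := prox A f g x p in dot p (z - w) <= D x w - D z w - D x z.
Proof.
move=> Ax Aw /=; rewrite proxE; set z := mirror_map _.
have := mirror_map_optimal (p - g x) Aw; rewrite -/z.
rewrite /bregman !(dotDl, dotDr, dotNl, dotNr); lra.
Qed.

Lemma prox_in x p : A (prox A f g x p).
Proof. by rewrite proxE; exact: mirror_map_in. Qed.

Lemma dual_young x y p : dot p (x - y) <= Nd p ^+ 2 / (2 * mu) + mu / 2 * N (x - y) ^+ 2.
Proof.
rewrite dotC (le_trans (dot_le_dual_norm N_norm _ _))//.
set a := N _; set b := Nd p; rewrite -subr_ge0.
have -> : b ^+ 2 / (2 * mu) + mu / 2 * a ^+ 2 - a * b = (b - mu * a) ^+ 2 / (2 * mu).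
  by field; rewrite gt_eqF.
by rewrite divr_ge0 ?sqr_ge0// mulr_ge0// ltW.
Qed.

(** The mirror descent inequality that serves the auxiliary sequence: Young's inequality pays for
    <p, x - z> with the term - D x z of the three-point bound. *)
Lemma prox_step x p w : A x -> A w ->
  dot p (x - w) <= D x w - D (prox A f g x p) w + Nd p ^+ 2 / (2 * mu).
Proof.
move=> Ax Aw; have := prox_three_point p Ax Aw; have := prox_in x p.
set z := prox _ _ _ _ _ => /= Az.
have := bregman_ge Ax Az; have := dual_young x z p.
by rewrite !dotBr; lra.
Qed.

(** With y and z the two prox points, write <v, y - w> = <v, z - w> + <u, y - z> + <v - u, y - z>.
    The three-point bounds for v at w and for u at z cancel D x z, and the remaining - D y z absorbs
    the quadratic term of Young's inequality. *)
Lemma mirror_prox_step x u v w : A x -> A w ->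
  dot v (prox A f g x u - w) <=
    D x w - D (prox A f g x v) w + Nd (v - u) ^+ 2 / (2 * mu).
Proof.
move=> Ax Aw; have Az := prox_in x v; have Ay := prox_in x u.
have := prox_three_point v Ax Aw; have := prox_three_point u Ax Az.
set z := prox _ _ _ x v in Az *; set y := prox _ _ _ x u in Ay * => /=.
have := bregman_ge Ay Az; have := bregman_ge0 Ax Ay; have := dual_young y z (v - u).
by rewrite !(dotDl, dotDr, dotNl, dotNr); lra.
Qed.

End Prox.

(** * Borel measurability in R^n *)

Section Borel.
Context {R : realType}.

Lemma borel_rV_open n (U : set 'rV[R]_n) :
  open U -> measurable (U : set (borel_rV R n)).
Proof. exact: sub_sigma_algebra. Qed.

Lemma borel_rV_closed n (U : set 'rV[R]_n) :
  closed U -> measurable (U : set (borel_rV R n)).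
Proof.
by move=> /closed_openC/borel_rV_open/measurableC; rewrite setCK.
Qed.

Lemma continuous_borel_rV_real n (f : 'rV[R]_n -> R) :
  continuous f -> measurable_fun setT (f : borel_rV R n -> R).
Proof.
move=> /continuousP cf; apply: (measurability _ (RGenOpens.measurableE R)).
move=> _ [_ [a [b ->] <-]]; rewrite setTI; apply: borel_rV_open.
exact/cf/interval_open.
Qed.

Lemma within_continuous_borel_rV n p (A : set 'rV[R]_n) (f : 'rV[R]_n -> 'rV[R]_p) :
  closed A -> {within A, continuous f} ->
  measurable_fun (A : set (borel_rV R n)) (f : borel_rV R n -> borel_rV R p).
Proof.
move=> cA /continuousP cf.
apply: (@measurability _ _ (borel_rV R n) (borel_rV R p) A f
  (@open 'rV[R]_p)) => //.
move=> _ [U oU <-].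
have /open_subspaceP[V oV VA] := cf _ oU.
rewrite setIC -VA; apply: measurableI; first exact: borel_rV_open.
exact: borel_rV_closed.
Qed.

Lemma continuous_borel_rV n p (f : 'rV[R]_n -> 'rV[R]_p) : continuous f ->
  measurable_fun setT (f : borel_rV R n -> borel_rV R p).
Proof.
move=> cf; apply: within_continuous_borel_rV; first exact: closedT.
exact: continuous_subspaceT.
Qed.

Lemma ratr_approx (x e : R) : 0 < e -> exists q : rat, `|ratr q - x| < e.
Proof.
move=> e0; have /rat_in_itvoo[q] : x - e < x + e by lra.
by rewrite in_itv/= => /andP[h1 h2]; exists q; rewrite ltr_norml; apply/andP; split; lra.
Qed.

(** An open set is a countable union of boxes with rational centre and radius 1 / (k+1), and the
    preimage of a box is a finite intersection of coordinate preimages. *)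
Lemma measurable_rowP d (T : measurableType d) n (f : T -> 'rV[R]_n) :
  measurable_fun setT (f : T -> borel_rV R n) <->
  forall j, measurable_fun setT (fun w => f w 0 j).
Proof.
split=> [mf j|mf].
  apply: (@measurableT_comp _ _ _ _ (borel_rV R n) _ (fun x : borel_rV R n => x 0 j)) => //.
  by apply: continuous_borel_rV_real; exact: coord_continuous.
apply: (@measurability _ _ T (borel_rV R n) setT f (@open 'rV[R]_n)) => // _ [U oU <-]; rewrite setTI.
pose box (q : {ffun 'I_n -> rat} * nat) := [set x : 'rV[R]_n | forall j,
  `|ratr (q.1 j) - x 0 j| < q.2.+1%:R^-1].
have mbox q : measurable (f @^-1` box q).
  rewrite (_ : _ @^-1` _ = \big[setI/setT]_(j < n)
    ((fun w => f w 0 j) @^-1` ball (ratr (q.1 j) : R) q.2.+1%:R^-1)).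
    apply: bigsetI_measurable => j _; rewrite -[X in measurable X]setTI.
    by apply: mf => //; apply: open_measurable; exact: ball_open.
  rewrite -bigcap_seq; apply/seteqP; split => w /= h j => [_|]; first exact: h.
  by apply: h; rewrite /= mem_index_enum.
(* Boxes that are not inside [U] contribute [set0], so the union runs over a whole countable
   type. *)
have -> : f @^-1` U = \bigcup_q (if pselect (box q `<=` U) then f @^-1` box q else set0).
  apply/seteqP; split => [w Uw|w [q _]]; last first.
    by case: pselect => // qU; exact: qU.
  have /nbhs_ballP[e /= e0 eU] : nbhs (f w) U by apply: open_nbhs_nbhs.
  pose k := Num.truncn (2 / e).
  have k0 : k.+1%:R^-1 < e / 2 :> R.
    by rewrite invf_plt ?posrE ?divr_gt0// invf_div truncnS_gt.
  have ki : 0 < k.+1%:R^-1 :> R by [].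
  pose q : {ffun 'I_n -> rat} := [ffun j => sval (cid (ratr_approx (f w 0 j) ki))].
  have qw : box (q, k) (f w).
    by move=> j /=; rewrite ffunE; case: cid.
  suff qU : box (q, k) `<=` U by exists (q, k) => //; case: pselect.
  move=> z qz; apply: eU.
  rewrite /ball /= /mx_ball; split => // i j; rewrite !ord1.
  have := qw j; have := qz j => /= h1 h2.
  rewrite /ball/= (le_lt_trans (ler_distD (ratr (q j)) _ _))//.
  rewrite (distrC (f w 0 j)). by rewrite [ltRHS]splitr ltrD// (lt_trans _ k0).
apply: countable_bigcupT_measurable => // q.
by case: pselect => ? /=; [exact: mbox|exact: measurable0].
Qed.

Lemma measurable_within_comp d (T : measurableType d) n p (A : set 'rV[R]_n)
    (h : 'rV[R]_n -> 'rV[R]_p) (f : T -> 'rV[R]_n) :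
  closed A -> {within A, continuous h} -> (forall w, A (f w)) ->
  measurable_fun setT (f : T -> borel_rV R n) ->
  measurable_fun setT ((h \o f) : T -> borel_rV R p).
Proof.
move=> cA ch Af mf; apply: (@measurable_comp _ _ _ _ (borel_rV R n) _ A).
- exact: borel_rV_closed.
- by move=> _ [w _ <-].
- exact: within_continuous_borel_rV.
- exact: mf.
Qed.

Lemma measurable_rowD d (T : measurableType d) n (f h : T -> 'rV[R]_n) :
  measurable_fun setT (f : T -> borel_rV R n) ->
  measurable_fun setT (h : T -> borel_rV R n) ->
  measurable_fun setT ((fun w => f w + h w) : T -> borel_rV R n).
Proof.
move=> /measurable_rowP mf /measurable_rowP mh; apply/measurable_rowP => j.
under eq_fun do rewrite mxE.
exact: measurable_funD.
Qed.

Lemma measurable_rowZ d (T : measurableType d) n (a : R) (f : T -> 'rV[R]_n) :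
  measurable_fun setT (f : T -> borel_rV R n) ->
  measurable_fun setT ((fun w => a *: f w) : T -> borel_rV R n).
Proof.
move=> /measurable_rowP mf; apply/measurable_rowP => j.
under eq_fun do rewrite mxE.
exact: measurable_funM.
Qed.

Lemma measurable_rowB d (T : measurableType d) n (f h : T -> 'rV[R]_n) :
  measurable_fun setT (f : T -> borel_rV R n) ->
  measurable_fun setT (h : T -> borel_rV R n) ->
  measurable_fun setT ((fun w => f w - h w) : T -> borel_rV R n).
Proof.
move=> mf mh; under eq_fun do rewrite -scaleN1r.
by apply: measurable_rowD => //; exact: measurable_rowZ.
Qed.

Lemma measurable_dot d (T : measurableType d) n (f h : T -> 'rV[R]_n) :
  measurable_fun setT (f : T -> borel_rV R n) ->
  measurable_fun setT (h : T -> borel_rV R n) ->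
  measurable_fun setT (fun w => dot (f w) (h w)).
Proof.
move=> /measurable_rowP mf /measurable_rowP mh.
by apply: measurable_sum => j; exact: measurable_funM.
Qed.

Lemma measurable_submxrow d (T : measurableType d) k (n : 'I_k -> nat)
    (f : T -> 'rV[R]_(\sum_i n i)) i :
  measurable_fun setT (f : T -> borel_rV R (\sum_i n i)) ->
  measurable_fun setT ((fun w => submxrow (f w) i) : T -> borel_rV R (n i)).
Proof.
move=> /measurable_rowP mf; apply/measurable_rowP => j.
under eq_fun do rewrite mxE.
exact: mf.
Qed.

Lemma measurable_mxrow d (T : measurableType d) k (n : 'I_k -> nat)
    (f : forall i, T -> 'rV[R]_(n i)) :
  (forall i, measurable_fun setT (f i : T -> borel_rV R (n i))) ->
  measurable_fun setT ((fun w => \mxrow_i f i w) : T -> borel_rV R (\sum_i n i)).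
Proof.
move=> mf; apply/measurable_rowP => j; under eq_fun do rewrite mxE.
by have /measurable_rowP := mf (tagnat.sig1 j); exact.
Qed.

Lemma measurable_is_norm d (T : measurableType d) n (N : 'rV[R]_n -> R)
    (f : T -> 'rV[R]_n) : is_norm N ->
  measurable_fun setT (f : T -> borel_rV R n) ->
  measurable_fun setT (fun w => N (f w)).
Proof.
move=> NN mf; apply: (@measurableT_comp _ _ _ _ (borel_rV R n) _ N) => //.
by apply: continuous_borel_rV_real; exact: is_norm_continuous.
Qed.

End Borel.

Section MeasurableProx.
Context {R : realType} {n : nat}.
Variables (N : 'rV[R]_n -> R) (A : set 'rV[R]_n).
Variables (f : 'rV[R]_n -> R) (g : 'rV[R]_n -> 'rV[R]_n) (mu L B : R).
Hypotheses (N_norm : is_norm N) (A_neq0 : A !=set0) (A_closed : closed A)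
  (A_convex : convex_set A) (A_bounded : forall x, A x -> N x <= B).
Hypotheses (f_C1 : C1_on A f g) (mu_gt0 : 0 < mu) (L_ge0 : 0 <= L).
Hypothesis f_strong : forall x y, A x -> A y ->
  f x + dot (g x) (y - x) + mu / 2 * N (x - y) ^+ 2 <= f y.
Hypothesis f_smooth : forall x y, A x -> A y ->
  f y <= f x + dot (g x) (y - x) + L / 2 * N (x - y) ^+ 2.

Lemma mirror_map_continuous : continuous (mirror_map A f).
Proof.
have [M M0 NM] := norm_le_is_norm N_norm.
have [M' M'0 NM'] := is_norm_le_norm (dual_norm_is_norm N_norm).
move=> p; apply/(@cvgrPdist_le _ _ _ (nbhs p)) => e e0; apply/nbhs_ballP.
exists (e * mu / (M * M')); first by rewrite /= divr_gt0 ?mulr_gt0.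
move=> q; rewrite -ball_normE /= => pq.
have := mirror_map_lipschitz N_norm A_neq0 A_closed A_convex A_bounded f_C1 L_ge0
  f_strong f_smooth p q.
move=> h; rewrite (le_trans (NM _))//.
rewrite -ler_pdivlMl// -(ler_pM2l mu_gt0) (le_trans h)// (le_trans (NM' _))//.
rewrite -ler_pdivlMl// (le_trans (ltW pq))// le_eqVlt; apply/orP; left.
apply/eqP; field; rewrite !gt_eqF//.
Qed.

(** Through [mirror_map], joint measurability in (x, v) reduces to that of v - g x, followed by a
    continuous map. The gradient is continuous only relative to [A], where x stays. *)
Lemma measurable_prox d (T : measurableType d) (x v : T -> 'rV[R]_n) :
  (forall w, A (x w)) ->
  measurable_fun setT (x : T -> borel_rV R n) ->
  measurable_fun setT (v : T -> borel_rV R n) ->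
  measurable_fun setT ((fun w => prox A f g (x w) (v w)) : T -> borel_rV R n).
Proof.
move=> Ax mx mv; under eq_fun do rewrite proxE.
apply: (@measurableT_comp _ _ _ _ (borel_rV R n) _ (mirror_map A f : borel_rV R n -> borel_rV R n)).
  by apply: continuous_borel_rV; exact: mirror_map_continuous.
apply: measurable_rowB => //.
by apply: (measurable_within_comp A_closed) => //; case: f_C1.
Qed.

End MeasurableProx.

(** * Independence *)

Section Independence.
Context {R : realType} {dT : measure_display} {T : measurableType dT}.
Variable P : probability T R.

(** Grouping lemma: finite intersections of events taken from the families indexed by [J] form a
    pi-system generating the sigma-algebra, and two finite measures agreeing on it coincide. *)
Lemma independent_generated (I : choiceType) (S : I -> set (set T)) (J : set I)
    (i0 : I) (A B : set T) :
  (forall i, sigma_algebra setT (S i)) -> (forall i, S i `<=` measurable) ->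
  mutually_independent P S -> ~ J i0 ->
  <<s \bigcup_(i in J) S i >> A -> S i0 B -> P (A `&` B) = (P A * P B)%E.
Proof.
move=> sS mS indS Ji0 sA SB.
pose G := [set X : set T | exists s (E : I -> set T), [/\ uniq s,
  forall i, i \in s -> J i, forall i, i \in s -> S i (E i) &
  X = \bigcap_(i in [set` s]) E i]].
have ST i : S i setT by have [S0 + _] := sS i => /(_ _ S0); rewrite setD0.
have SI i X Y : S i X -> S i Y -> S i (X `&` Y).
  have sub Z : S i Z -> Z `<=` setT by [].
  by have [_ _ _] := (sigma_algebraP sub).1 (sS i); apply.
have Gm : G `<=` measurable.
  move=> _ [s [E [_ _ SE ->]]]; rewrite bigcap_seq big_seq_cond.
  by apply: bigsetI_measurable => i /andP[/SE/mS].
have GI : setI_closed G.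
  move=> _ _ [s [E [us Js SE ->]]] [s' [E' [us' Js' SE' ->]]].
  (* An index present in only one list gets [setT] from the other. *)
  exists (undup (s ++ s')), (fun i => (if i \in s then E i else setT) `&`
                                      (if i \in s' then E' i else setT)); split.
  - exact: undup_uniq.
  - by move=> i; rewrite mem_undup mem_cat => /orP[/Js|/Js'].
  - move=> i _; apply: SI; case: ifPn => // ?; [exact: SE|exact: SE'].
  - apply/seteqP; split => w /=.
      by move=> [h h'] i _; split; case: ifPn => // ?; [exact: h|exact: h'].
    move=> h; split=> i /= si; have := h i; rewrite /= mem_undup mem_cat si ?orbT.
      by move=> /(_ isT)[].
    by move=> /(_ isT)[].
have GT : G setT by exists [::], (fun=> setT); split => //; apply/seteqP; split => // w _ i.
have JG : \bigcup_(i in J) S i `<=` G.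
  move=> X [i Ji SX]; exists [:: i], (fun=> X); split => //.
  - by move=> j; rewrite inE => /eqP->.
  - by move=> j; rewrite inE => /eqP->.
  - apply/seteqP; split => [w Xw j //|w]; apply; exact: mem_head.
have mB := mS _ _ SB.
have PB0 : 0 <= fine (P B) by rewrite fine_ge0.
(* The measures to compare are P(. [&] B) and P(B) P(.). *)
pose m1 : {measure set T -> \bar R} := mrestr P mB.
pose m2 : {measure set T -> \bar R} := mscale (NngNum PB0) P.
have m2E X : m2 X = (P X * P B)%E.
  by rewrite /m2 /= /mscale /= fineK ?fin_num_measure// muleC.
rewrite -m2E; change (m1 A = m2 A).
apply: (@g_sigma_algebra_measure_unique _ _ _ G Gm (fun=> setT)) => //.
- by rewrite bigcup_const.
- move=> _ [s [E [us Js SE ->]]]; rewrite m2E /m1 /= /mrestr.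
  have i0s : i0 \notin s by apply/negP => /Js.
  rewrite indS//.
  rewrite -[RHS]muleC.
  (* Since [i0] is outside [J], hence outside [s], [B] can be inserted as one more factor at index
     [i0]. *)
  pose E' i := if i == i0 then B else E i.
  have E'E i : i \in s -> E' i = E i.
    by move=> si; rewrite /E'; case: eqP => // ii0; rewrite ii0 (negbTE i0s) in si.
  have -> : \bigcap_(i in [set` s]) E i `&` B = \bigcap_(i in [set` i0 :: s]) E' i.
    apply/seteqP; split => w.
      move=> [h Bw] i /=; rewrite inE => /predU1P[->|si]; first by rewrite /E' eqxx.
      by rewrite E'E//; exact: h.
    move=> h; split => [i /= si|].
      by rewrite -E'E//; apply: h; rewrite /= inE si orbT.
    by have := h i0; rewrite /E' eqxx; apply; rewrite /= inE eqxx.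
  rewrite indS.
  + rewrite big_cons {1}/E' eqxx; congr (_ * _)%E.
    by apply: eq_big_seq => i /E'E ->.
  + by rewrite /= i0s.
  + move=> i; rewrite inE => /predU1P[->|si]; first by rewrite /E' eqxx.
    by rewrite E'E//; exact: SE.
- by move=> _; rewrite /m1/= /mrestr setTI ltey_eq fin_num_measure.
- by apply: sub_smallest2r sA.
Qed.

Lemma sigma_rv_algebra d' (T' : measurableType d') (Z : T -> T') :
  sigma_algebra setT (sigma_rv Z).
Proof.
split.
- by exists set0 => //; rewrite preimage_set0 setI0.
- move=> _ [A mA <-]; exists (~` A); first exact: measurableC.
  by rewrite !setTI setTD.
- move=> E SE.
  pose F n := sval (cid2 (SE n)).
  exists (\bigcup_n F n).
    by apply: bigcupT_measurable => n; rewrite /F; case: cid2.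
  rewrite setTI preimage_bigcup; apply: eq_bigcupr => n _.
  by rewrite /F; case: cid2 => /= X _; rewrite setTI.
Qed.

Lemma sigma_rv_measurable d' (T' : measurableType d') (Z : T -> T') :
  measurable_fun setT Z -> sigma_rv Z `<=` measurable.
Proof. by move=> mZ _ [A mA <-]; exact: mZ. Qed.

Section Product.
Context {d1 d2} {T1 : measurableType d1} {T2 : measurableType d2}.
Variables (Y : T -> T1) (Z : T -> T2).
Hypotheses (mY : measurable_fun setT Y) (mZ : measurable_fun setT Z).
Hypothesis indep : forall A B, measurable A -> measurable B ->
  P (Y @^-1` A `&` Z @^-1` B) = (P (Y @^-1` A) * P (Z @^-1` B))%E.

HB.instance Definition _ := isMeasurableFun.Build _ _ _ _ Y mY.
HB.instance Definition _ := isMeasurableFun.Build _ _ _ _ Z mZ.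

Let YZ w := (Y w, Z w).

Let mYZ : measurable_fun setT YZ.
Proof. exact: measurable_fun_pair. Qed.

HB.instance Definition _ := isMeasurableFun.Build _ _ _ _ YZ mYZ.

(** Independence is equality of the joint law and the product law on rectangles, hence on all
    measurable sets; Tonelli and Fubini are then transported from the product measure. *)
Let distribution_pair X : measurable X ->
  (distribution P Y \x distribution P Z)%E X = distribution P YZ X.
Proof. by apply: product_measure_unique => A B mA mB; exact: indep. Qed.

Local Open Scope ereal_scope.

Lemma indep_tonelli (h : T1 * T2 -> \bar R) : measurable_fun setT h ->
  (forall z, 0 <= h z) ->
  \int[P]_w h (Y w, Z w) = \int[P]_w \int[P]_w' h (Y w, Z w').
Proof.
move=> mh h0.
rewrite -(@ge0_integral_distribution _ _ _ _ _ P YZ h)//.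
rewrite (eq_measure_integral (distribution P Y \x distribution P Z)); last first.
  by move=> A mA _; apply/esym; exact: distribution_pair.
rewrite fubini_tonelli1// ge0_integral_distribution//; last 2 first.
- exact: measurable_fun_fubini_tonelli_F.
- by move=> y; exact: integral_ge0.
apply: eq_integral => w _; rewrite /= /fubini_F.
rewrite (@ge0_integral_distribution _ _ _ _ _ P Z (fun z => h (Y w, z)))//.
exact: measurableT_comp.
Qed.

Lemma indep_fubini (h : T1 * T2 -> \bar R) : measurable_fun setT h ->
  P.-integrable setT (fun w => h (Y w, Z w)) ->
  (forall w, P.-integrable setT (fun w' => h (Y w, Z w'))) ->
  \int[P]_w h (Y w, Z w) = \int[P]_w \int[P]_w' h (Y w, Z w').
Proof.
move=> mh ih ih2.
rewrite -(@integral_distribution _ _ _ _ _ P YZ h)//.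
have iYZ : (distribution P YZ).-integrable setT h.
  exact: (@integrable_pushforward _ _ _ _ _ _ mYZ).
have iprod : (distribution P Y \x distribution P Z).-integrable setT h.
  apply/integrableP; split => //.
  move/integrableP : iYZ => [_]; congr (_ < _); apply: eq_measure_integral.
  by move=> A mA _; apply/esym; exact: distribution_pair.
rewrite (eq_measure_integral (distribution P Y \x distribution P Z)); last first.
  by move=> A mA _; apply/esym; exact: distribution_pair.
rewrite -integral12_prod_meas1//.
have mF := measurable_fubini_F iprod.
have iF := integrable_fubini_F iprod.
rewrite (@integral_distribution _ _ _ _ _ P Y)//.
  apply: eq_integral => w _; rewrite /= /fubini_F.
  rewrite (@integral_distribution _ _ _ _ _ P Z (fun z => h (Y w, z)))//.
    exact: measurableT_comp.
  exact: ih2.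
apply/integrableP; split; first exact: measurableT_comp.
move/integrableP : iF => [_]; congr (_ < _).
by rewrite ge0_integral_distribution//; exact: measurableT_comp.
Qed.

End Product.

(** Takes the place of conditioning on the past: [Y] is a function of the samples in [J] and [Z] is
    a fresh sample. *)
Lemma adapted_independent (I : choiceType) (S : I -> set (set T)) (J : set I)
    (i0 : I) d1 d2 (T1 : measurableType d1) (T2 : measurableType d2)
    (Y : T -> T1) (Z : T -> T2) :
  (forall i, sigma_algebra setT (S i)) -> (forall i, S i `<=` measurable) ->
  mutually_independent P S -> ~ J i0 -> S i0 = sigma_rv Z ->
  measurable_fun (setT : set (g_sigma_algebraType (\bigcup_(i in J) S i))) Y ->
  forall A B, measurable A -> measurable B ->
  P (Y @^-1` A `&` Z @^-1` B) = (P (Y @^-1` A) * P (Z @^-1` B))%E.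
Proof.
move=> sS mS indS Ji0 SZ mY A B mA mB.
apply: (independent_generated sS mS indS Ji0).
- by have := mY measurableT A mA; rewrite setTI.
- by rewrite SZ; exists B => //; rewrite setTI.
Qed.

(* Spares a proof that the gap function, a supremum over [X], is measurable. *)
Lemma le_integral_nonmeasurable (f g : T -> \bar R) :
  (forall w, 0 <= f w)%E -> (forall w, f w <= g w)%E ->
  (\int[P]_w f w <= \int[P]_w g w)%E.
Proof.
move=> f0 fg.
rewrite ge0_integralTE// ge0_integralTE; last by move=> w; exact: le_trans (fg w).
apply: le_ereal_sup => _ [h /= hf <-]; exists h => // w.
exact: le_trans (fg w).
Qed.

End Independence.

(** * Pathwise analysis *)

(** Summation by parts. The induction carries the sharper bound w_K (M - a_(K+1)), which survives an
    increase of the weight because a <= M. *)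
Lemma sum_weighted_telescope {R : realType} (w a : nat -> R) (M : R) :
  (forall k, 0 <= w k) -> (forall k, w k <= w k.+1) ->
  (forall k, 0 <= a k <= M) -> forall K, (0 < K)%N ->
  \sum_(k < K) w k * (a k - a k.+1) <= w K.-1 * M.
Proof.
move=> w0 wS aM [//|K] _ /=.
suff h : \sum_(k < K.+1) w k * (a k - a k.+1) <= w K * (M - a K.+1).
  by rewrite (le_trans h)// ler_wpM2l// gerBl; case/andP: (aM K.+1).
elim: K => [|K IH].
  rewrite big_ord_recr big_ord0/= add0r ler_wpM2l// lerD2r.
  by case/andP: (aM 0%N).
rewrite big_ord_recr/=.
have := wS K; have := aM K.+1; have := w0 K => ? /andP[? ?] ?.
have : w K * (M - a K.+1) <= w K.+1 * (M - a K.+1) by rewrite ler_wpM2r// subr_ge0.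
lra.
Qed.

Section Averages.
Context {R : realType} {N : nat}.
Variables (gamma : nat -> R) (r : R).
Hypothesis gamma_gt0 : forall k, 0 < gamma k.

Lemma GamE K : Gam gamma r K = \sum_(k < K) gamma k `^ r.
Proof. by elim: K => [|K IH]; rewrite ?big_ord0// big_ord_recr/= IH. Qed.

Lemma Gam_ge0 K : 0 <= Gam gamma r K.
Proof. by rewrite GamE sumr_ge0// => k _; exact: powR_ge0. Qed.

Lemma Gam_gt0 K : 0 < Gam gamma r K.+1.
Proof. by rewrite /= ltr_wpDl ?Gam_ge0// powR_gt0. Qed.

Lemma ybar_sum (y : nat -> 'rV[R]_N) K : (0 < K)%N ->
  Gam gamma r K *: ybar gamma r y K = \sum_(k < K) gamma k `^ r *: y k.+1.
Proof.
case: K => // K _; elim: K => [|K IH]; rewrite /= big_ord_recr/=.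
  rewrite big_ord0 !add0r scale0r add0r scalerA mulfV ?scale1r//.
  by rewrite gt_eqF// powR_gt0.
rewrite scalerA mulfV ?scale1r; first by rewrite -IH.
by rewrite gt_eqF//; exact: (Gam_gt0 K.+1).
Qed.

Lemma ybar_convex (A : set 'rV[R]_N) (y : nat -> 'rV[R]_N) K :
  (forall a b t, A a -> A b -> 0 <= t <= 1 -> A (a + t *: (b - a))) ->
  (forall k, A (y k.+1)) -> (0 < K)%N -> A (ybar gamma r y K).
Proof.
move=> cA Ay; case: K => // K _; elim: K => [|K IH].
  rewrite /= add0r scale0r add0r scalerA mulVf ?scale1r//.
  by rewrite gt_eqF// powR_gt0.
set t := gamma K.+1 `^ r / Gam gamma r K.+2.
have t0 : 0 <= t by rewrite divr_ge0 ?powR_ge0 ?Gam_ge0.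
have G2 := Gam_gt0 K.+1.
have t1 : t <= 1 by rewrite ler_pdivrMr// mul1r [leRHS]/= lerDr; exact: (Gam_ge0 K.+1).
have t01 : 0 <= t <= 1 by rewrite t0.
have := cA _ _ _ IH (Ay K.+1) t01; congr A.
have -> : ybar gamma r y K.+2 = (Gam gamma r K.+2)^-1 *:
  (Gam gamma r K.+1 *: ybar gamma r y K.+1 + gamma K.+1 `^ r *: y K.+2) by [].
have G2E : Gam gamma r K.+1 = Gam gamma r K.+2 - gamma K.+1 `^ r.
  by rewrite [in RHS]/= addrK.
rewrite G2E /t; move: (Gam gamma r K.+2) G2 (gamma K.+1 `^ r) => b b0 a.
move: (ybar gamma r y K.+1) (y K.+2) => p q.
by apply/rowP => j; rewrite !mxE; field; rewrite gt_eqF.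
Qed.

End Averages.

Section Blocks.
Context {R : realType} {d : nat} {n : 'I_d -> nat}.
Local Notation V := 'rV[R]_(\sum_i n i).
Implicit Types u v w : V.

Lemma submxrowZ a u i : submxrow (a *: u) i = a *: submxrow u i.
Proof. by apply/rowP => j; rewrite !mxE. Qed.

Lemma submxrowDE u v i : submxrow (u + v) i = submxrow u i + submxrow v i.
Proof. by apply/rowP => j; rewrite !mxE. Qed.

Lemma submxrowBE u v i : submxrow (u - v) i = submxrow u i - submxrow v i.
Proof. by apply/rowP => j; rewrite !mxE. Qed.

Lemma bdotE u v : bdot u v = dot u v.
Proof.
have dotmx k (a b : 'rV[R]_k) : dot a b = (a *m b^T) 0 0.
  by rewrite mxE; apply: eq_bigr => j _; rewrite mxE.
rewrite /bdot dotmx -[in RHS](submxrowK u) -[in RHS](submxrowK v) tr_mxrow.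
by rewrite mul_mxrow_mxcol summxE; apply: eq_bigr => i _; rewrite dotmx.
Qed.

End Blocks.

(** * The mirror-prox recursion coupled with the auxiliary sequence *)

Section MirrorProx.
Context {R : realType} {d : nat} {n : 'I_d -> nat}.
Variable nrm : forall i, 'rV[R]_(n i) -> R.
Arguments nrm : clear implicits.
Hypothesis nrm_norm : forall i, is_norm (nrm i).
Variable X : forall i, set 'rV[R]_(n i).
Arguments X : clear implicits.
Hypotheses (X_neq0 : forall i, X i !=set0) (X_closed : forall i, closed (X i))
  (X_convex : forall i, convex_set (X i)).
Variable B : 'I_d -> R.
Hypothesis X_bounded : forall i x, X i x -> nrm i x <= B i.
Variables (omega : forall i, 'rV[R]_(n i) -> R)
  (grad : forall i, 'rV[R]_(n i) -> 'rV[R]_(n i)) (mu L : 'I_d -> R).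
Arguments omega : clear implicits.
Arguments grad : clear implicits.
Hypotheses (omega_C1 : forall i, C1_on (X i) (omega i) (grad i))
  (mu_gt0 : forall i, 0 < mu i) (L_ge0 : forall i, 0 <= L i).
Hypothesis omega_strongly_convex : forall i x y, X i x -> X i y ->
  omega i x + dot (grad i x) (y - x) + mu i / 2 * nrm i (x - y) ^+ 2 <= omega i y.
Hypothesis omega_smooth : forall i x y, X i x -> X i y ->
  omega i y <= omega i x + dot (grad i x) (y - x) + L i / 2 * nrm i (x - y) ^+ 2.

Local Notation V := 'rV[R]_(\sum_i n i).

Definition bprox (x v : V) : V :=
  \mxrow_i prox (X i) (omega i) (grad i) (submxrow x i) (submxrow v i).

Definition bdual (i : 'I_d) (v : V) : R := dual_norm (nrm i) (submxrow v i).

Lemma bprox_in x v : setprod X (bprox x v).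
Proof.
move=> i; rewrite mxrowK.
exact: (prox_in (nrm_norm i) (X_neq0 i) (@X_closed i) (@X_bounded i) (omega_C1 i)).
Qed.

Lemma setprod_segment a b t : setprod X a -> setprod X b -> 0 <= t <= 1 ->
  setprod X (a + t *: (b - a)).
Proof.
move=> Xa Xb t01 i.
have := convex_segment (@X_convex i) (Xa i) (Xb i) t01.
by congr (X i _); apply/rowP => j; rewrite !mxE.
Qed.

Let Db x z := \sum_i bregman (omega i) (grad i) (submxrow x i) (submxrow z i).

Variables (F : V -> V) (C : 'I_d -> R).
Hypothesis F_monotone : forall x y, setprod X x -> setprod X y ->
  0 <= bdot (F x - F y) (x - y).
Hypothesis F_bounded : forall i x, setprod X x -> bdual i (F x) <= C i.

Let Di i z a := bregman (omega i) (grad i) (submxrow a i) (submxrow z i).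

(** Split F y = gs - Delta and y - z = (y - u) + (u - z) in the noise part. The step from [x] bounds
    <gs, y - z>, the auxiliary step from [u], driven by -Delta, bounds -<Delta, u - z>, and -<Delta,
    y - u> is kept for the expectation. *)
Lemma mirror_prox_block i (x u z gt gs y x' u' : V) c : setprod X x ->
  setprod X u -> setprod X z -> 0 <= c ->
  y = bprox x (c *: gt) -> x' = bprox x (c *: gs) ->
  u' = bprox u (- c *: (gs - F y)) ->
  c * dot (submxrow (F y) i) (submxrow (y - z) i) <=
    (Di i z x + Di i z u) - (Di i z x' + Di i z u') +
    c ^+ 2 * (2 / mu i * (2 * C i ^+ 2 + bdual i (gt - F x) ^+ 2 +
                          5 / 4 * bdual i (gs - F y) ^+ 2)) -
    c * dot (submxrow (gs - F y) i) (submxrow (y - u) i).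
Proof.
move=> Xx Xu Xz c0 yE x'E u'E.
have Xy : setprod X y by rewrite yE; exact: bprox_in.
set D := Di i z.
have Nd := dual_norm_is_norm (nrm_norm i).
have h1 := mirror_prox_step (nrm_norm i) (X_neq0 i) (@X_closed i) (@X_convex i)
  (@X_bounded i) (omega_C1 i) (mu_gt0 i) (L_ge0 i) (@omega_strongly_convex i)
  (@omega_smooth i) (submxrow (c *: gt) i) (submxrow (c *: gs) i) (Xx i) (Xz i).
have h2 := prox_step (nrm_norm i) (X_neq0 i) (@X_closed i) (@X_convex i)
  (@X_bounded i) (omega_C1 i) (mu_gt0 i) (L_ge0 i) (@omega_strongly_convex i)
  (@omega_smooth i) (submxrow (- c *: (gs - F y)) i) (Xu i) (Xz i).
have ex : prox (X i) (omega i) (grad i) (submxrow x i) (submxrow (c *: gs) i)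
  = submxrow x' i by rewrite x'E mxrowK.
have ey : prox (X i) (omega i) (grad i) (submxrow x i) (submxrow (c *: gt) i)
  = submxrow y i by rewrite yE mxrowK.
have eu : prox (X i) (omega i) (grad i) (submxrow u i)
  (submxrow (- c *: (gs - F y)) i) = submxrow u' i by rewrite u'E mxrowK.
rewrite ex ey in h1; rewrite eu in h2.
rewrite -/(D x) -/(D x') in h1; rewrite -/(D u) -/(D u') in h2.
have {}h1 : c * dot (submxrow gs i) (submxrow (y - z) i) <=
    D x - D x' + c ^+ 2 * bdual i (gs - gt) ^+ 2 / (2 * mu i).
  move: h1; rewrite !submxrowZ dotZl -scalerBr -!submxrowBE.
  by rewrite (is_normZ Nd) ger0_norm// exprMn.
have {}h2 : - c * dot (submxrow (gs - F y) i) (submxrow (u - z) i) <=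
    D u - D u' + c ^+ 2 * bdual i (gs - F y) ^+ 2 / (2 * mu i).
  move: h2; rewrite !submxrowZ dotZl -submxrowBE.
  by rewrite (is_normZ Nd) normrN ger0_norm// exprMn.
set e := bdual i (gs - F y) in h2 *; set et := bdual i (gt - F x).
have e0 : 0 <= e by exact: dual_norm_ge0.
have et0 : 0 <= et by exact: dual_norm_ge0.
(* The oracle answers differ by two noises and by F y - F x, of dual norm at most 2 C. *)
have h3 : bdual i (gs - gt) <= e + 2 * C i + et.
  have -> : gs - gt = (gs - F y) + (F y - F x) - (gt - F x).
    by apply/rowP => j; rewrite !mxE; ring.
  rewrite /bdual submxrowBE (le_trans (is_normB Nd _ _))// lerD//.
  rewrite submxrowDE (le_trans (is_normD Nd _ _))// lerD// submxrowBE.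
  rewrite (le_trans (is_normB Nd _ _))//.
  have := F_bounded i Xx; have := F_bounded i Xy; rewrite /bdual; lra.
have C0 : 0 <= C i.
  by apply: le_trans (F_bounded i Xx); exact: dual_norm_ge0.
have h4 : bdual i (gs - gt) ^+ 2 <= 4 * e ^+ 2 + 8 * C i ^+ 2 + 4 * et ^+ 2.
  have g0 : 0 <= bdual i (gs - gt) by exact: dual_norm_ge0.
  have : bdual i (gs - gt) ^+ 2 <= (e + 2 * C i + et) ^+ 2.
    by rewrite ler_sqr ?nnegrE//; exact: le_trans h3.
  move/le_trans; apply.
  (* (a+b+c)^2 <= 2b^2 + 2(a+c)^2 <= 4a^2 + 2b^2 + 4c^2 *)
  have := sqr_ge0 (e - et); have := sqr_ge0 (e + et - 2 * C i); nra.
have m0 := mu_gt0 i.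
(* Origin of 5/4: the noise [e] has weight 4 in the square above and weight 1 in the auxiliary step,
   and (4 + 1) / (2 mu) = (2 / mu)(5 / 4). *)
have h5 : c ^+ 2 * bdual i (gs - gt) ^+ 2 / (2 * mu i) +
    c ^+ 2 * e ^+ 2 / (2 * mu i) <=
    c ^+ 2 * (2 / mu i * (2 * C i ^+ 2 + et ^+ 2 + 5 / 4 * e ^+ 2)).
  have -> : c ^+ 2 * (2 / mu i * (2 * C i ^+ 2 + et ^+ 2 + 5 / 4 * e ^+ 2)) =
     c ^+ 2 * (4 * e ^+ 2 + 8 * C i ^+ 2 + 4 * et ^+ 2) / (2 * mu i) +
     c ^+ 2 * e ^+ 2 / (2 * mu i).
    by field; rewrite gt_eqF.
  rewrite lerD2r ler_pM2r ?invr_gt0 ?mulr_gt0//.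
  by rewrite ler_wpM2l// sqr_ge0.
move: h1 h2 h5; rewrite !submxrowBE !(dotDl, dotDr, dotNl, dotNr).
lra.
Qed.

Variables (gamma : nat -> R) (r : R).
Hypotheses (r_lt1 : r < 1) (gamma_gt0 : forall k, 0 < gamma k)
  (gamma_nonincreasing : forall k, gamma k.+1 <= gamma k).
Variables x y u gt gs : nat -> V.
Hypotheses (x0_in : setprod X (x 0%N)) (u0_in : setprod X (u 0%N)).
Hypothesis y_step : forall k, y k.+1 = bprox (x k) (gamma k *: gt k).
Hypothesis x_step : forall k, x k.+1 = bprox (x k) (gamma k *: gs k).
Hypothesis u_step : forall k,
  u k.+1 = bprox (u k) (- gamma k *: (gs k - F (y k.+1))).

(** Telescoped distances, squared oracle errors, and a noise term of mean zero. The index [K.-1] is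
    that of the last weight gamma_k^(r-1), the largest one. *)
Definition mirror_prox_error K : R :=
  4 * gamma K.-1 `^ (r - 1) * (\sum_i L i * B i ^+ 2) +
  \sum_(k < K) gamma k `^ (r + 1) * (\sum_i 2 / mu i *
    (2 * C i ^+ 2 + bdual i (gt k - F (x k)) ^+ 2 +
     5 / 4 * bdual i (gs k - F (y k.+1)) ^+ 2)) -
  \sum_(k < K) gamma k `^ r * bdot (gs k - F (y k.+1)) (y k.+1 - u k).

Lemma mirror_prox_regret K z : (0 < K)%N -> setprod X z ->
  \sum_(k < K) gamma k `^ r * bdot (F z) (y k.+1 - z) <= mirror_prox_error K.
Proof.
move=> K0 Xz.
have Xx k : setprod X (x k) by case: k => // k; rewrite x_step; exact: bprox_in.
have Xu k : setprod X (u k) by case: k => // k; rewrite u_step; exact: bprox_in.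
have Xy k : setprod X (y k.+1) by rewrite y_step; exact: bprox_in.
pose a k := Db (x k) z + Db (u k) z.
have Db01 v : setprod X v -> 0 <= Db v z <= 2 * \sum_i L i * B i ^+ 2.
  move=> Xv; apply/andP; split.
    apply: sumr_ge0 => i _.
    exact: (bregman_ge0 (mu_gt0 i) (@omega_strongly_convex i)).
  rewrite mulr_sumr; apply: ler_sum => i _; rewrite mulrA.
  exact: (bregman_le (nrm_norm i) (@X_bounded i) (L_ge0 i) (@omega_smooth i)).
have a01 k : 0 <= a k <= 4 * \sum_i L i * B i ^+ 2.
  have := Db01 _ (Xx k); have := Db01 _ (Xu k); rewrite /a; lra.
pose w k := gamma k `^ (r - 1).
have w0 k : 0 <= w k by exact: powR_ge0.
have wS k : w k <= w k.+1.
  rewrite /w -[r - 1]opprB !powRN lef_pV2 ?posrE ?powR_gt0//.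
  apply: ge0_ler_powR; rewrite ?nnegrE ?(ltW (gamma_gt0 _)) ?gamma_nonincreasing//. by rewrite subr_ge0 ltW.
have key k : gamma k `^ r * bdot (F z) (y k.+1 - z) <=
  w k * (a k - a k.+1) + gamma k `^ (r + 1) * (\sum_i 2 / mu i *
    (2 * C i ^+ 2 + bdual i (gt k - F (x k)) ^+ 2 +
     5 / 4 * bdual i (gs k - F (y k.+1)) ^+ 2)) -
  gamma k `^ r * bdot (gs k - F (y k.+1)) (y k.+1 - u k).
  have g0 := gamma_gt0 k.
  have gr : gamma k `^ r = w k * gamma k.
    have : gamma k `^ (r - 1 + 1) = w k * gamma k.
      by rewrite powRD ?(gt_eqF g0) ?implybT// powRr1// ltW.
    by rewrite subrK.
  have gr1 : gamma k `^ (r + 1) = w k * gamma k ^+ 2.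
    have -> : r + 1 = r - 1 + 2%:R by ring.
    by rewrite powRD ?(gt_eqF g0) ?implybT// powR_mulrn// ltW.
  rewrite gr gr1 -!mulrA -mulrDr -mulrBr ler_wpM2l//.
  (* Monotonicity moves [F] from the iterate to the fixed point [z]; the weighted sum is then affine
     in the iterates and passes to their average. *)
  have mono : bdot (F z) (y k.+1 - z) <= bdot (F (y k.+1)) (y k.+1 - z).
    by have := F_monotone (Xy k) Xz; rewrite !bdotE dotBl subr_ge0.
  apply: le_trans (ler_wpM2l (ltW g0) mono) _.
  rewrite /a /Db /bdot !mulr_sumr -!big_split/= -!sumrB -!big_split/= -sumrB.
  apply: ler_sum => i _.
  by rewrite (mulrA (gamma k) (gamma k)) -expr2;
    exact: (mirror_prox_block i (Xx k) (Xu k) Xz (ltW g0) (y_step k) (x_step k)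
    (u_step k)).
apply: le_trans; first by apply: ler_sum => k _; exact: key.
rewrite sumrB big_split/= lerD2r lerD2r.
apply: le_trans (sum_weighted_telescope w0 wS a01 K0) _.
by rewrite /w; lra.
Qed.

Lemma gap_le K : (0 < K)%N ->
  (gap (setprod X) F (ybar gamma r y K) <=
    ((\sum_(k < K) gamma k `^ r)^-1 * mirror_prox_error K)%:E)%E.
Proof.
move=> K0; apply: ge_ereal_sup => _ [z Xz <-]; rewrite lee_fin.
have G0 : 0 < \sum_(k < K) gamma k `^ r.
  by rewrite -GamE; case: K K0 => // K _; exact: Gam_gt0.
rewrite ler_pdivlMl//; apply: le_trans (mirror_prox_regret K0 Xz).
rewrite -GamE !bdotE -dotZr scalerBr ybar_sum// GamE scaler_suml -sumrB.
rewrite dot_sumr; apply: ler_sum => k _.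
by rewrite -scalerBr dotZr bdotE.
Qed.

(** The average lies in the convex set [X] and competes in the supremum with value 0. Nonnegativity
    is what permits monotonicity of the integral without measurability of the gap. *)
Lemma gap_ge0 K : (0 < K)%N -> (0 <= gap (setprod X) F (ybar gamma r y K))%E.
Proof.
move=> K0; apply: ereal_sup_ubound; exists (ybar gamma r y K).
  apply: ybar_convex => // [a b t|k]; first exact: setprod_segment.
  by rewrite y_step; exact: bprox_in.
by rewrite subrr bdotE dot0r.
Qed.

End MirrorProx.

(** * Expectation of the oracle noise *)

(** The Tonelli measurability statement concerns nonnegative functions, hence the splitting into
    positive and negative parts. *)
Lemma measurable_integral_section d1 d2 (T1 : measurableType d1)
    (T2 : measurableType d2) (R : realType)
    (m2 : {sigma_finite_measure set T2 -> \bar R}) (f : T1 * T2 -> \bar R) :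
  measurable_fun setT f -> measurable_fun setT (fun x => \int[m2]_y f (x, y))%E.
Proof.
move=> mf.
rewrite (_ : (fun x => _) = (fubini_F m2 f^\+ \- fubini_F m2 f^\-)%E); last first.
  apply/funext => x; rewrite [LHS]integralE.
  under eq_integral do rewrite funepos_comp/=.
  by under [X in (_ - X)%E = _]eq_integral do rewrite funeneg_comp/=.
apply: emeasurable_funB; apply: measurable_fun_fubini_tonelli_F => //.
- exact: measurable_funepos.
- exact: measurable_funeneg.
Qed.

Section ExpectationBound.
Context {R : realType} {dT : measure_display} {T : measurableType dT}.
Variable P : probability T R.

Lemma integral_probability_cst a : (\int[P]_(w in setT) (cst a w)%:E = a%:E)%E.
Proof.
transitivity (a%:E * P setT)%E; first exact: (integral_cst P measurableT a%:E).
by rewrite probability_setT mule1.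
Qed.

(** Bundling integrability with the bound gives a predicate stable under sums and nonnegative
    multiples, so a bound can be assembled term by term. *)
Definition expect_le (f : T -> R) (b : R) : Prop :=
  P.-integrable setT (EFin \o f) /\ (\int[P]_w (f w)%:E <= b%:E)%E.

Lemma expect_le_cst a : expect_le (cst a) a.
Proof.
split; first exact: finite_measure_integrable_cst.
by rewrite integral_probability_cst.
Qed.

Lemma expect_leD f g a b : expect_le f a -> expect_le g b ->
  expect_le (fun w => f w + g w) (a + b).
Proof.
move=> [fi fa] [gi gb]; split; first by have := integrableD measurableT fi gi.
under eq_integral do rewrite EFinD.
by rewrite integralD// EFinD leeD.
Qed.

Lemma expect_leZ f a c : 0 <= c -> expect_le f a ->
  expect_le (fun w => c * f w) (c * a).
Proof.
move=> c0 [fi fa]; split; first by have := integrableZl measurableT c fi.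
under eq_integral do rewrite EFinM.
by rewrite integralZl// EFinM lee_wpmul2l// lee_fin.
Qed.

Lemma expect_le_sum K (f : 'I_K -> T -> R) (a : 'I_K -> R) :
  (forall k, expect_le (f k) (a k)) ->
  expect_le (fun w => \sum_k f k w) (\sum_k a k).
Proof.
elim: K f a => [|K IH] f a fa.
  rewrite big_ord0; under eq_fun do rewrite big_ord0.
  exact: expect_le_cst.
rewrite big_ord_recr; under eq_fun do rewrite big_ord_recr.
by apply: expect_leD => //; exact: IH.
Qed.

Lemma expect_le_ge0 (f : T -> R) b : measurable_fun setT f -> (forall w, 0 <= f w) ->
  (\int[P]_w (f w)%:E <= b%:E)%E -> expect_le f b.
Proof.
move=> mf f0 fb; split => //; apply/integrableP; split; first exact/measurable_EFinP.
apply: le_lt_trans (ltry b); apply: le_trans fb.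
rewrite le_eqVlt; apply/orP; left; apply/eqP.
by apply: eq_integral => w _ /=; rewrite ger0_norm.
Qed.

End ExpectationBound.

(** * Oracle noise at a random point *)

Section Noise.
Context {R : realType} {N m : nat}.
Local Notation V := 'rV[R]_N.
Variables (A : set V) (A_closed : closed A).
Variable Phi : V -> 'rV[R]_m -> V.
Hypothesis Phi_measurable : @measurable_fun _ _
  (borel_rV R N * borel_rV R m)%type (borel_rV R N)
  (A `*` setT) (fun p => Phi p.1 p.2).
Context {dT : measure_display} {T : measurableType dT} (P : probability T R).
Variable xi : {RV P >-> borel_rV R m}.
Variable F : V -> V.
Hypothesis Phi_integrable : forall x j, A x ->
  P.-integrable setT (fun w => (Phi x (xi w) 0 j)%:E).
Hypothesis F_def : forall x, A x ->
  F x = vec_expectation P (fun w => Phi x (xi w)).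

(* [Phi] and [F] are only controlled on [A]; extending them by 0 gives maps that
   are measurable everywhere. *)
Let Phi0 (p : borel_rV R N * borel_rV R m) : borel_rV R N :=
  if p.1 \in A then Phi p.1 p.2 else 0.

Let F0 (x : borel_rV R N) : borel_rV R N := if x \in A then F x else 0.

Let measurable_inA : measurable_fun setT (fun x : borel_rV R N => x \in A).
Proof.
apply: (measurable_fun_bool true); rewrite setTI.
rewrite (_ : _ @^-1` _ = A); first exact: borel_rV_closed.
by apply/seteqP; split => x => [/set_mem|/mem_set].
Qed.

Let measurable_Phi0 : measurable_fun setT Phi0.
Proof.
apply: measurable_fun_if => //.
- by apply: (@measurableT_comp _ _ _ _ _ _ (fun x : borel_rV R N => x \in A)).
- rewrite setTI (_ : _ @^-1` _ = A `*` setT)//.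
  apply/seteqP; split => -[x s] /=; first by move=> /set_mem.
  by move=> [/mem_set].
Qed.

(** Coordinatewise, [F0] is a partial integral of the jointly measurable [Phi0] against the law of
    [xi]. *)
Let measurable_F0 : measurable_fun setT F0.
Proof.
apply/measurable_rowP => j.
have -> : (fun x => F0 x 0 j) =
    (fun x => fine (\int[distribution P xi]_s (Phi0 (x, s) 0 j)%:E)).
  apply/funext => x; rewrite /F0 integral_distribution//.
  - have [xA|xA] := boolP (x \in A).
      rewrite F_def ?mxE ?unlock; last exact: set_mem.
      by congr fine; apply: eq_integral => w _ /=; rewrite /Phi0 /= xA.
    rewrite mxE integral0_eq// => w _ /=; rewrite /Phi0 /= (negbTE xA).
    by rewrite mxE.
  - apply/measurable_EFinP.
    have /measurable_rowP/(_ j) mPhi := measurable_Phi0.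
    exact: (measurableT_comp mPhi (pair1_measurable x)).
  - have [xA|xA] := boolP (x \in A).
      apply: eq_integrable (Phi_integrable j (set_mem xA)) => // w _ /=.
      by rewrite /Phi0 /= xA.
    apply: eq_integrable (integrable0 _ _) => // w _ /=.
    by rewrite /Phi0 /= (negbTE xA) mxE.
apply: measurableT_comp => //.
apply: (measurable_integral_section (distribution P xi)
  (f := fun p => (Phi0 p 0 j)%:E)).
apply/measurable_EFinP.
by have /measurable_rowP := measurable_Phi0; exact.
Qed.

Lemma measurable_oracle d (T' : measurableType d) (x : T' -> V)
    (s : T' -> 'rV[R]_m) : (forall w, A (x w)) ->
  measurable_fun setT (x : T' -> borel_rV R N) ->
  measurable_fun setT (s : T' -> borel_rV R m) ->
  measurable_fun setT ((fun w => Phi (x w) (s w)) : T' -> borel_rV R N).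
Proof.
move=> Ax mx ms.
rewrite (_ : (fun w => _) = Phi0 \o (fun w => (x w, s w))).
  by apply: measurableT_comp => //; exact: measurable_fun_pair.
by apply/funext => w; rewrite /Phi0 /= ifT// inE.
Qed.

Lemma measurable_mean d (T' : measurableType d) (x : T' -> V) :
  (forall w, A (x w)) ->
  measurable_fun setT (x : T' -> borel_rV R N) ->
  measurable_fun setT ((fun w => F (x w)) : T' -> borel_rV R N).
Proof.
move=> Ax mx; rewrite (_ : (fun w => _) = F0 \o x).
  exact: measurableT_comp.
by apply/funext => w; rewrite /F0 /= ifT// inE.
Qed.

Let noise p := Phi0 p - F0 p.1.

Let measurable_noise : measurable_fun setT (noise : _ -> borel_rV R N).
Proof.
apply: measurable_rowB => //.
by apply: measurableT_comp.
Qed.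

Let noiseE x s : A x -> noise (x, s) = Phi x s - F x.
Proof. by move=> Ax; rewrite /noise /Phi0 /F0 /= ifT ?inE// ifT ?inE. Qed.

Section OneSample.
Variables (Z : {RV P >-> borel_rV R m}).

(** Independence and Tonelli freeze [Y]; the inner integral is then the bound at a fixed point,
    uniform over [A]. It is used with [psi] a squared dual norm. *)
Lemma noise_expect_le (psi : V -> R) (Y : T -> V) b :
  measurable_fun setT (psi : borel_rV R N -> R) -> (forall v, 0 <= psi v) ->
  (forall w, A (Y w)) -> measurable_fun setT (Y : T -> borel_rV R N) ->
  (forall B C, measurable (B : set (borel_rV R N)) -> measurable C ->
    P (Y @^-1` B `&` Z @^-1` C) = (P (Y @^-1` B) * P (Z @^-1` C))%E) ->
  (forall x, A x -> ('E_P[fun w => psi (Phi x (Z w) - F x)%R] <= b%:E)%E) ->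
  expect_le P (fun w => psi (Phi (Y w) (Z w) - F (Y w))) b.
Proof.
move=> mpsi psi0 AY mY YZ hb.
have mh : measurable_fun setT (fun p => (psi (noise p))%:E).
  by apply/measurable_EFinP; apply: (@measurableT_comp _ _ _ _ (borel_rV R N) _ psi).
apply: expect_le_ge0 => //.
  apply: (@measurableT_comp _ _ _ _ (borel_rV R N) _ psi) => //.
  apply: measurable_rowB; first exact: measurable_oracle.
  exact: measurable_mean.
have -> : (\int[P]_w (psi (Phi (Y w) (Z w) - F (Y w)))%:E =
    \int[P]_w (psi (noise (Y w, Z w)))%:E)%E.
  by apply: eq_integral => w _; rewrite noiseE.
rewrite (@indep_tonelli _ _ _ P _ _ (borel_rV R N) _ Y Z _ _ YZ
  (fun p => (psi (noise p))%:E))//; last by move=> p; rewrite lee_fin.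
rewrite -(integral_probability_cst P b).
apply: le_integral_nonmeasurable => w.
  by apply: integral_ge0 => w' _; rewrite lee_fin.
apply: le_trans (hb _ (AY w)); rewrite unlock le_eqVlt; apply/orP; left; apply/eqP.
by apply: eq_integral => w' _; rewrite noiseE.
Qed.

Hypothesis Z_law : same_distribution Z xi.

(** Integrability and the mean are known for [xi] and are transported to the sample [Z] through
    equality of laws. *)
Let integrable_sample x j : A x ->
  P.-integrable setT (fun w => (Phi x (Z w) 0 j)%:E) /\
  (\int[P]_w (Phi x (Z w) 0 j)%:E = (F x 0 j)%:E)%E.
Proof.
move=> Ax.
have mPhi : measurable_fun setT (fun s : borel_rV R m => (Phi x s 0 j)%:E).
  apply/measurable_EFinP.
  have : measurable_fun setT ((fun s => Phi x s) : borel_rV R m -> borel_rV R N).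
    by apply: (@measurable_oracle _ (borel_rV R m) (fun=> x) (fun s => s)).
  by move=> /measurable_rowP; exact.
have ixi := Phi_integrable j Ax.
have dxi : (distribution P xi).-integrable setT (fun s => (Phi x s 0 j)%:E).
  exact: (@integrable_pushforward _ _ _ _ _ xi).
have iZ : P.-integrable setT (fun w => (Phi x (Z w) 0 j)%:E).
  apply/integrableP; split; first by apply: (measurableT_comp mPhi).
  have /integrableP[_] := ixi; congr (_ < _)%E.
  rewrite -(@ge0_integral_distribution _ _ _ _ _ P xi (fun s => `|(Phi x s 0 j)%:E|)%E)//;
    last exact: measurableT_comp.
  rewrite -(@ge0_integral_distribution _ _ _ _ _ P Z (fun s => `|(Phi x s 0 j)%:E|)%E)//;
    last exact: measurableT_comp.
  by apply: eq_measure_integral => B mB _; apply/esym; exact: Z_law.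
split => //.
rewrite -(@integral_distribution _ _ _ _ _ P Z (fun s => (Phi x s 0 j)%:E))//.
rewrite (eq_measure_integral (distribution P xi)); last by move=> B mB _; exact: Z_law.
rewrite integral_distribution// F_def// mxE unlock fineK//.
exact: integrable_fin_num.
Qed.

(** With [Y] and [U] frozen, the inner integral is a finite combination of centred coordinates,
    hence 0. *)
Lemma noise_mean0 (Y U : T -> V) :
  (forall w, A (Y w)) -> measurable_fun setT (Y : T -> borel_rV R N) ->
  measurable_fun setT (U : T -> borel_rV R N) ->
  (forall B C, measurable (B : set (borel_rV R N * borel_rV R N)) -> measurable C ->
    P ((fun w => (Y w, U w)) @^-1` B `&` Z @^-1` C) =
      (P ((fun w => (Y w, U w)) @^-1` B) * P (Z @^-1` C))%E) ->
  P.-integrable setT (fun w => (dot (Phi (Y w) (Z w) - F (Y w)) (U w))%:E) ->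
  (\int[P]_w (dot (Phi (Y w) (Z w) - F (Y w)) (U w))%:E = 0)%E.
Proof.
move=> AY mY mU YUZ iYU.
pose h (p : (borel_rV R N * borel_rV R N) * borel_rV R m) : \bar R :=
  (dot (noise (p.1.1, p.2)) p.1.2)%:E.
have mh : measurable_fun setT h.
  apply/measurable_EFinP; apply: measurable_dot.
    apply: measurableT_comp => //; apply: measurable_fun_pair => //.
    by apply: measurableT_comp.
  by apply: measurableT_comp.
have hE w w' : h ((Y w, U w), Z w') = (dot (Phi (Y w) (Z w') - F (Y w)) (U w))%:E.
  by rewrite /h /= noiseE.
(* Fubini requires each section to be integrable in addition to the integrability of the whole. *)
have int_inner w : P.-integrable setT (fun w' => h ((Y w, U w), Z w')) /\
    (\int[P]_w' h ((Y w, U w), Z w') = 0)%E.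
  have hs w' : h ((Y w, U w), Z w') = (\sum_(j < N) (U w 0 j)%:E *
      ((Phi (Y w) (Z w') 0 j)%:E - (F (Y w) 0 j)%:E))%E.
    rewrite hE /dot -sumEFin; apply: eq_bigr => j _.
    by rewrite !mxE mulrC EFinM EFinB.
  have ij j : P.-integrable setT (fun w' =>
      ((Phi (Y w) (Z w') 0 j)%:E - (F (Y w) 0 j)%:E)%E).
    apply: integrableB => //; first by have [] := integrable_sample j (AY w).
    exact: finite_measure_integrable_cst.
  have ij' j : P.-integrable setT (fun w' => (U w 0 j)%:E *
      ((Phi (Y w) (Z w') 0 j)%:E - (F (Y w) 0 j)%:E))%E.
    exact: integrableZl.
  under eq_fun do rewrite hs; split.
    exact: integrable_sum.
  rewrite integral_sum// big1// => j _.
  rewrite integralZl// integralB//; last 2 first.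
  - by have [] := integrable_sample j (AY w).
  - exact: finite_measure_integrable_cst.
  have [_ ->] := integrable_sample j (AY w).
  by rewrite integral_probability_cst subee// mule0.
have -> : (\int[P]_w (dot (Phi (Y w) (Z w) - F (Y w)) (U w))%:E =
    \int[P]_w h ((Y w, U w), Z w))%E.
  by apply: eq_integral => w _; rewrite hE.
rewrite (@indep_fubini _ _ _ P _ _ (borel_rV R N * borel_rV R N)%type _
  (fun w => (Y w, U w)) Z _ _ YUZ h)//.
- by rewrite integral0_eq// => w _; have [] := int_inner w.
- exact: measurable_fun_pair.
- by under eq_fun do rewrite hE.
- by move=> w; have [] := int_inner w.
Qed.

End OneSample.

End Noise.

(** * The stochastic algorithm *)

Section Adapted.
Context {dT : measure_display} {T : measurableType dT}.
Context {I : Type} (S : I -> set (set T)).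

(** [J] is a set of sample indices rather than a time, since the two half-steps of one iteration see
    different samples. *)
Definition adapted (J : set I) d (T' : measurableType d) (f : T -> T') : Prop :=
  measurable_fun (setT : set (g_sigma_algebraType (\bigcup_(i in J) S i))) f.

Lemma adapted_sub (J J' : set I) d (T' : measurableType d) (f : T -> T') :
  J `<=` J' -> adapted J f -> adapted J' f.
Proof.
move=> JJ' mf _ A mA; have := mf measurableT A mA.
apply: sub_smallest2r; first exact: smallest_sigma_algebra.
exact: bigcup_subset.
Qed.

Lemma adapted_measurable (J : set I) d (T' : measurableType d) (f : T -> T') :
  (forall i, S i `<=` measurable) -> adapted J f -> measurable_fun setT f.
Proof.
move=> mS mf _ A mA; have := mf measurableT A mA.
apply: smallest_sub; first exact: sigma_algebra_measurable.
by apply: bigcup_sub => i _; exact: mS.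
Qed.

Lemma adapted_sigma_rv (J : set I) i d (T' : measurableType d) (f : T -> T') :
  J i -> S i = sigma_rv f -> adapted J f.
Proof.
move=> Ji Sf _ A mA; apply: sub_sigma_algebra; exists i => //.
by rewrite Sf; exists A.
Qed.

End Adapted.

Section BlockMeasurability.
Context {R : realType} {d : nat} {n : 'I_d -> nat}.
Local Notation V := 'rV[R]_(\sum_i n i).

Lemma norm_submxrow (x : V) i : `|submxrow x i| <= `|x|.
Proof.
rewrite [leLHS]/Num.norm/= mx_normrE; apply/bigmax_leP; split => // -[a j] _ /=.
by rewrite mxE ord1 coord_le_norm.
Qed.

Lemma submxrow_continuous i : continuous (fun x : V => submxrow x i).
Proof.
move=> x; apply/(@cvgrPdist_le _ _ _ (nbhs x)) => e e0; apply/nbhs_ballP.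
exists e => // y; rewrite -ball_normE /= => xy.
by rewrite -submxrowBE (le_trans (norm_submxrow _ _))// ltW.
Qed.

Lemma setprod_closed (X : forall i, set 'rV[R]_(n i)) :
  (forall i, closed (X i)) -> closed (setprod X).
Proof.
move=> cX; rewrite (_ : setprod X = \bigcap_i ((fun x : V => submxrow x i) @^-1` X i)).
  apply: closed_bigI => i _; apply: closed_comp => // x _.
  exact: submxrow_continuous.
by apply/seteqP; split => [x Xx i _|x Xx i]; [exact: Xx|exact: (Xx i)].
Qed.

Lemma measurable_bdual (nrm : forall i, 'rV[R]_(n i) -> R) i : is_norm (nrm i) ->
  measurable_fun setT (bdual nrm i : borel_rV R (\sum_i n i) -> R).
Proof.
move=> hN; apply: measurable_is_norm; first exact: dual_norm_is_norm.
by apply: measurable_submxrow; exact: measurable_id.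
Qed.

End BlockMeasurability.

Section StochasticMirrorProx.
Context {R : realType} {d m : nat} {n : 'I_d -> nat}.
Variable nrm : forall i, 'rV[R]_(n i) -> R.
Arguments nrm : clear implicits.
Hypothesis nrm_norm : forall i, is_norm (nrm i).
Variable X : forall i, set 'rV[R]_(n i).
Arguments X : clear implicits.
Hypotheses (X_neq0 : forall i, X i !=set0) (X_closed : forall i, closed (X i))
  (X_convex : forall i, convex_set (X i)).
Variable B : 'I_d -> R.
Hypothesis X_bounded : forall i x, X i x -> nrm i x <= B i.
Variables (omega : forall i, 'rV[R]_(n i) -> R)
  (grad : forall i, 'rV[R]_(n i) -> 'rV[R]_(n i)) (mu L : 'I_d -> R).
Arguments omega : clear implicits.
Arguments grad : clear implicits.
Hypotheses (omega_C1 : forall i, C1_on (X i) (omega i) (grad i))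
  (mu_gt0 : forall i, 0 < mu i) (L_ge0 : forall i, 0 <= L i).
Hypothesis omega_strongly_convex : forall i x y, X i x -> X i y ->
  omega i x + dot (grad i x) (y - x) + mu i / 2 * nrm i (x - y) ^+ 2 <= omega i y.
Hypothesis omega_smooth : forall i x y, X i x -> X i y ->
  omega i y <= omega i x + dot (grad i x) (y - x) + L i / 2 * nrm i (x - y) ^+ 2.

Local Notation V := 'rV[R]_(\sum_i n i).
Local Notation bV := (borel_rV R (\sum_i n i)).

Context {dT : measure_display} {T : measurableType dT} (P : probability T R).
Variable Phi : V -> 'rV[R]_m -> V.
Hypothesis Phi_measurable : @measurable_fun _ _
  (borel_rV R (\sum_i n i) * borel_rV R m)%type (borel_rV R (\sum_i n i))
  (setprod X `*` setT) (fun p => Phi p.1 p.2).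
Variables (xi : {RV P >-> borel_rV R m}) (xis xits : nat -> {RV P >-> borel_rV R m})
  (x0 : {RV P >-> borel_rV R (\sum_i n i)}).
Hypothesis x0_in : forall w, setprod X (x0 w).
Hypothesis xis_law : forall k, same_distribution (xis k) xi.
Hypothesis samples_independent :
  mutually_independent P (sample_sigma x0 xis xits).
Variable F : V -> V.
Hypothesis Phi_integrable : forall x j, setprod X x ->
  P.-integrable setT (fun w => (Phi x (xi w) 0 j)%:E).
Hypothesis F_def : forall x, setprod X x ->
  F x = vec_expectation P (fun w => Phi x (xi w)).
Hypothesis F_monotone : forall x y, setprod X x -> setprod X y ->
  0 <= bdot (F x - F y) (x - y).
Variable C : 'I_d -> R.
Hypothesis F_bounded : forall i x, setprod X x -> bdual nrm i (F x) <= C i.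
Variables nu nut : 'I_d -> R.
Hypothesis R3t : forall i k x, setprod X x ->
  ('E_P[fun w => (bdual nrm i (Phi x (xits k w) - F x) ^+ 2)%R] <= (nut i ^+ 2)%:E)%E.
Hypothesis R3 : forall i k x, setprod X x ->
  ('E_P[fun w => (bdual nrm i (Phi x (xis k w) - F x) ^+ 2)%R] <= (nu i ^+ 2)%:E)%E.
Variables (r : R) (gamma : nat -> R).
Hypotheses (r_lt1 : r < 1) (gamma_gt0 : forall k, 0 < gamma k)
  (gamma_nonincreasing : forall k, gamma k.+1 <= gamma k).
Variables x y : nat -> T -> V.
Hypothesis x_init : forall w, x 0%N w = x0 w.
Hypothesis y_step : forall k w, y k.+1 w =
  bprox X omega grad (x k w) (gamma k *: Phi (x k w) (xits k w)).
Hypothesis x_step : forall k w, x k.+1 w =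
  bprox X omega grad (x k w) (gamma k *: Phi (y k.+1 w) (xis k w)).

(* The auxiliary sequence [a] of the header. *)
Fixpoint aux k w : V :=
  if k is k'.+1 then bprox X omega grad (aux k' w)
    (- gamma k' *: (Phi (y k'.+1 w) (xis k' w) - F (y k'.+1 w)))
  else x0 w.

Let bprox_X u v : setprod X (bprox X omega grad u v).
Proof. exact: (bprox_in nrm_norm X_neq0 X_closed X_bounded omega_C1). Qed.

Let x_in k w : setprod X (x k w).
Proof. by case: k => [|k]; rewrite ?x_init ?x_step; [exact: x0_in|exact: bprox_X]. Qed.

Let y_in k w : setprod X (y k.+1 w).
Proof. by rewrite y_step; exact: bprox_X. Qed.

Let aux_in k w : setprod X (aux k w).
Proof. by case: k => [|k]; [exact: x0_in|exact: bprox_X]. Qed.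

Let measurable_bprox d' (T' : measurableType d') (u v : T' -> V) :
  (forall w, setprod X (u w)) ->
  measurable_fun setT (u : T' -> bV) -> measurable_fun setT (v : T' -> bV) ->
  measurable_fun setT ((fun w => bprox X omega grad (u w) (v w)) : T' -> bV).
Proof.
move=> Xu mu' mv; apply: measurable_mxrow => i.
apply: (measurable_prox (nrm_norm i) (X_neq0 i) (@X_closed i) (@X_convex i)
  (@X_bounded i) (omega_C1 i) (mu_gt0 i) (L_ge0 i) (@omega_strongly_convex i)
  (@omega_smooth i)).
- by move=> w; exact: Xu.
- exact: measurable_submxrow.
- exact: measurable_submxrow.
Qed.

Let S := sample_sigma x0 xis xits.

Let S_algebra i : sigma_algebra setT (S i).
Proof. by case: i => [[k|k]|]; exact: sigma_rv_algebra. Qed.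

Let S_measurable i : S i `<=` measurable.
Proof. by case: i => [[k|k]|]; apply: sigma_rv_measurable. Qed.

(* [past_x k] (resp. [past_y k]) indexes the samples on which [x k]
   (resp. [y k.+1]) depends; [None] is the initial point. *)
Definition past_x k : set (option (nat + nat)) := [set i |
  match i with
  | None => True
  | Some (inl j) => (j < k)%N
  | Some (inr j) => (j < k)%N
  end].
Definition past_y k : set (option (nat + nat)) := [set i |
  match i with
  | None => True
  | Some (inl j) => (j < k)%N
  | Some (inr j) => (j < k.+1)%N
  end].

Let past_xy k : past_x k `<=` past_y k.
Proof. by move=> [[j|j]|] //=; exact: ltnW. Qed.

Let past_yx k : past_y k `<=` past_x k.+1.
Proof. by move=> [[j|j]|] //=; exact: ltnW. Qed.

Let closedX : closed (setprod X) := setprod_closed X_closed.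

(** The measurability lemmas hold over an arbitrary domain and are instantiated here at [T] with the
    sigma-algebra of the samples in [J]. *)
Let adapted_oracle J (u : T -> V) (s : T -> 'rV[R]_m) :
  (forall w, setprod X (u w)) -> adapted S J (u : T -> bV) ->
  adapted S J (s : T -> borel_rV R m) ->
  adapted S J ((fun w => Phi (u w) (s w)) : T -> bV).
Proof.
exact: (@measurable_oracle _ _ _ _ (@closedX) _ Phi_measurable _
  (g_sigma_algebraType (\bigcup_(i in J) S i))).
Qed.

Let adapted_mean J (u : T -> V) :
  (forall w, setprod X (u w)) -> adapted S J (u : T -> bV) ->
  adapted S J ((fun w => F (u w)) : T -> bV).
Proof.
exact: (@measurable_mean _ _ _ _ (@closedX) _ Phi_measurable _ _ _ _ _
  Phi_integrable F_def _ (g_sigma_algebraType (\bigcup_(i in J) S i))).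
Qed.

Let adapted_y_of k : adapted S (past_x k) (x k : T -> bV) ->
  adapted S (past_y k) (y k.+1 : T -> bV).
Proof.
move=> /(adapted_sub (@past_xy k)) mx.
have mxi : adapted S (past_y k) (xits k).
  by apply: (@adapted_sigma_rv _ _ _ _ _ (Some (inr k))) => //=.
rewrite /adapted (_ : y k.+1 = fun w =>
  bprox X omega grad (x k w) (gamma k *: Phi (x k w) (xits k w))); last exact/funext.
apply: measurable_bprox => //.
apply: measurable_rowZ.
exact: adapted_oracle.
Qed.

Let adapted_xu k : adapted S (past_x k) (x k : T -> bV) /\
  adapted S (past_x k) (aux k : T -> bV).
Proof.
elim: k => [|k [mx mu']].
  rewrite /adapted (_ : x 0%N = x0); last exact/funext.
  by split; apply: (@adapted_sigma_rv _ _ _ _ _ None).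
have my := adapted_sub (@past_yx k) (adapted_y_of mx).
have {}mx := adapted_sub (@past_yx k) (adapted_sub (@past_xy k) mx).
have {}mu' := adapted_sub (@past_yx k) (adapted_sub (@past_xy k) mu').
have mxi : adapted S (past_x k.+1) (xis k).
  by apply: (@adapted_sigma_rv _ _ _ _ _ (Some (inl k))) => //=.
have mPhi := adapted_oracle (y_in k) my mxi.
split.
  rewrite /adapted (_ : x k.+1 = fun w =>
    bprox X omega grad (x k w) (gamma k *: Phi (y k.+1 w) (xis k w))); last exact/funext.
  by apply: measurable_bprox => //; exact: measurable_rowZ.
apply: measurable_bprox => //.
apply: measurable_rowZ; apply: measurable_rowB => //.
exact: adapted_mean.
Qed.

Let adapted_x k : adapted S (past_x k) (x k : T -> bV).
Proof. by have [] := adapted_xu k. Qed.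

Let adapted_y k : adapted S (past_y k) (y k.+1 : T -> bV).
Proof. exact: adapted_y_of. Qed.

Let adapted_u k : adapted S (past_y k) (aux k : T -> bV).
Proof. by apply: (adapted_sub (@past_xy k)); have [] := adapted_xu k. Qed.

Let mx k : measurable_fun setT (x k : T -> bV).
Proof. exact: (adapted_measurable S_measurable (@adapted_x k)). Qed.

Let my k : measurable_fun setT (y k.+1 : T -> bV).
Proof. exact: (adapted_measurable S_measurable (@adapted_y k)). Qed.

Let measurable_aux k : measurable_fun setT (aux k : T -> bV).
Proof. exact: (adapted_measurable S_measurable (@adapted_u k)). Qed.

Local Notation et i k w := (bdual nrm i (Phi (x k w) (xits k w) - F (x k w))).
Local Notation es i k w := (bdual nrm i (Phi (y k.+1 w) (xis k w) - F (y k.+1 w))).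

Let measurable_bdual2 i :
  measurable_fun setT ((fun v => bdual nrm i v ^+ 2) : bV -> R).
Proof. by apply: measurable_funX; exact: measurable_bdual. Qed.

Let et_le i k : expect_le P (fun w => et i k w ^+ 2) (nut i ^+ 2).
Proof.
apply: (noise_expect_le (@closedX) Phi_measurable Phi_integrable F_def
  (measurable_bdual2 i) _ (x_in k) (mx k)).
- by move=> v; exact: sqr_ge0.
- move=> E E' mE mE'.
  apply: (adapted_independent S_algebra S_measurable samples_independent _ _
    (@adapted_x k) mE mE' (i0 := Some (inr k))) => //=.
  by rewrite ltnn.
- by move=> v Xv; exact: R3t.
Qed.

(** [y k.+1] has consumed [xits k] but not [xis k], which is therefore fresh. *)
Let es_le i k : expect_le P (fun w => es i k w ^+ 2) (nu i ^+ 2).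
Proof.
apply: (noise_expect_le (@closedX) Phi_measurable Phi_integrable F_def
  (measurable_bdual2 i) _ (y_in k) (my k)).
- by move=> v; exact: sqr_ge0.
- move=> E E' mE mE'.
  apply: (adapted_independent S_algebra S_measurable samples_independent _ _
    (@adapted_y k) mE mE' (i0 := Some (inl k))) => //=.
  by rewrite ltnn.
- by move=> v Xv; exact: R3.
Qed.

Let drift k w := bdot (Phi (y k.+1 w) (xis k w) - F (y k.+1 w)) (y k.+1 w - aux k w).

Let measurable_noise k :
  measurable_fun setT ((fun w => Phi (y k.+1 w) (xis k w) - F (y k.+1 w)) : T -> bV).
Proof.
apply: measurable_rowB; first exact: (measurable_oracle (@closedX) Phi_measurable).
exact: (measurable_mean (@closedX) Phi_measurable Phi_integrable F_def).
Qed.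

(** Domination by squared noises: blockwise |<Delta, y - a>| <= 2 B e <= B (1 + e^2). *)
Let drift_integrable k : P.-integrable setT (fun w => (drift k w)%:E).
Proof.
have [ig _] : expect_le P (fun w => \sum_i B i * (1 + es i k w ^+ 2))
    (\sum_i B i * (1 + nu i ^+ 2)).
  apply: expect_le_sum => i; apply: expect_leZ.
    have [v Xv] := X_neq0 i; apply: le_trans (X_bounded Xv); exact: is_norm_ge0.
  by apply: expect_leD => //; exact: expect_le_cst.
apply: le_integrable ig => //.
  apply/measurable_EFinP; rewrite /drift; under eq_fun do rewrite bdotE.
  by apply: measurable_dot => //; exact: measurable_rowB.
move=> w _ /=; rewrite lee_fin; apply: le_trans (ler_norm _).
rewrite /drift /bdot (le_trans (ler_norm_sum _ _ _))//; apply: ler_sum => i _.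
rewrite dotC (le_trans (norm_dot_le_dual_norm (nrm_norm i) _ _))//.
rewrite submxrowBE -/(bdual nrm i _).
have h := is_normB (nrm_norm i) (submxrow (y k.+1 w) i) (submxrow (aux k w) i).
have h1 := X_bounded (y_in k w i); have h2 := X_bounded (aux_in k w i).
have e0 : 0 <= es i k w by exact: dual_norm_ge0.
have N0 := is_norm_ge0 (nrm_norm i) (submxrow (y k.+1 w) i).
have := sqr_ge0 (es i k w - 1); move: (es i k w) e0 => e e0 e1.
have e2 : 2 * e <= 1 + e ^+ 2 by lra.
have B0 : 0 <= B i by exact: le_trans h1.
apply: (@le_trans _ _ (2 * B i * e)).
  by rewrite ler_wpM2r//; lra.
by rewrite mulrAC mulrC ler_wpM2l.
Qed.

Let drift_expect k : expect_le P (fun w => - drift k w) 0.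
Proof.
split; first by have := integrableN (drift_integrable k).
have -> : (\int[P]_w (- drift k w)%:E = (-1)%:E * \int[P]_w (drift k w)%:E)%E.
  rewrite -(integralZl measurableT (drift_integrable k)).
  by apply: eq_integral => w _; rewrite -EFinM mulN1r.
have -> : (\int[P]_w (drift k w)%:E = 0)%E; last by rewrite mule0.
have YU := @drift_integrable k; rewrite /drift in YU *.
under eq_integral do rewrite bdotE.
apply: (noise_mean0 (@closedX) Phi_measurable Phi_integrable F_def (@xis_law k)
  (y_in k) (my k)).
- exact: measurable_rowB.
- move=> E E' mE mE'.
  have mYU : adapted S (past_y k) (fun w => (y k.+1 w : bV, (y k.+1 w - aux k w) : bV)).
    apply: measurable_fun_pair; first exact: adapted_y.
    exact: (@measurable_rowB _ _ (g_sigma_algebraType (\bigcup_(i in past_y k) S i))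
      _ _ _ (@adapted_y k) (@adapted_u k)).
  apply: (adapted_independent S_algebra S_measurable samples_independent _ _
    mYU mE mE' (i0 := Some (inl k))) => //=.
  by rewrite ltnn.
- by under eq_fun do rewrite -bdotE.
Qed.

Lemma expected_gap_le K : (0 < K)%N ->
  (\int[P]_w gap (setprod X) F (ybar gamma r (fun k => y k w) K)
   <= ((\sum_(k < K) gamma k `^ r)^-1 *
       (4 * gamma K.-1 `^ (r - 1) * (\sum_i L i * B i ^+ 2) +
        \sum_(k < K) gamma k `^ (r + 1) *
          \sum_i 2 / mu i *
            (2 * C i ^+ 2 + nut i ^+ 2 + 5 / 4 * nu i ^+ 2)))%:E)%E.
Proof.
move=> K0.
pose H w := (\sum_(k < K) gamma k `^ r)^-1 * mirror_prox_error nrm B mu L F C gamma r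
  (fun k => x k w) (fun k => y k w) (fun k => aux k w)
  (fun k => Phi (x k w) (xits k w)) (fun k => Phi (y k.+1 w) (xis k w)) K.
apply: (@le_trans _ _ (\int[P]_w (H w)%:E)%E).
  apply: le_integral_nonmeasurable => w.
    exact: (gap_ge0 nrm_norm X_neq0 X_closed X_convex X_bounded omega_C1 F r
      gamma_gt0 (fun k => y_step k w)).
  apply: (gap_le nrm_norm X_neq0 X_closed X_convex X_bounded omega_C1 mu_gt0 L_ge0
    omega_strongly_convex omega_smooth F_monotone F_bounded r_lt1 gamma_gt0
    gamma_nonincreasing (x_in 0%N w) (x0_in w)) => // k.
suff [] : expect_le P H ((\sum_(k < K) gamma k `^ r)^-1 *
       (4 * gamma K.-1 `^ (r - 1) * (\sum_i L i * B i ^+ 2) +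
        \sum_(k < K) gamma k `^ (r + 1) *
          \sum_i 2 / mu i *
            (2 * C i ^+ 2 + nut i ^+ 2 + 5 / 4 * nu i ^+ 2))) by [].
apply: expect_leZ; first by rewrite invr_ge0 sumr_ge0// => k _; exact: powR_ge0.
(* Only nonnegative multiples are allowed, so the minus sign is moved onto the drift, whose bound is
   0. *)
suff : expect_le P (fun w => 4 * gamma K.-1 `^ (r - 1) * (\sum_i L i * B i ^+ 2) +
    \sum_(k < K) gamma k `^ (r + 1) * (\sum_i 2 / mu i *
      (2 * C i ^+ 2 + et i k w ^+ 2 + 5 / 4 * es i k w ^+ 2)) +
    \sum_(k < K) gamma k `^ r * - drift k w)
   (4 * gamma K.-1 `^ (r - 1) * (\sum_i L i * B i ^+ 2) +
    \sum_(k < K) gamma k `^ (r + 1) * (\sum_i 2 / mu i *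
      (2 * C i ^+ 2 + nut i ^+ 2 + 5 / 4 * nu i ^+ 2)) +
    \sum_(k < K) gamma k `^ r * 0).
  have -> : \sum_(k < K) gamma k `^ r * 0 = 0 by rewrite big1// => k _; rewrite mulr0.
  rewrite addr0; congr expect_le; apply/funext => w; rewrite /mirror_prox_error -sumrN.
  by congr (_ + _); apply: eq_bigr => k _; rewrite mulrN.
apply: expect_leD; first apply: expect_leD; first exact: expect_le_cst.
- apply: expect_le_sum => k; apply: expect_leZ; first exact: powR_ge0.
  apply: expect_le_sum => i; apply: expect_leZ; first by rewrite divr_ge0// ltW.
  apply: expect_leD; first apply: expect_leD; first exact: expect_le_cst.
  + exact: et_le.
  + by apply: expect_leZ; [lra|exact: es_le].
- apply: expect_le_sum => k.
  by apply: expect_leZ; [exact: powR_ge0|exact: drift_expect].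
Qed.

End StochasticMirrorProx.

(** * Stepsizes proportional to 1 / sqrt(k+1) *)

Section SqrtStepsize.
Context {R : realType}.
Variables (g0 r : R) (gamma : nat -> R).
Hypotheses (g0_gt0 : 0 < g0) (r_lt1 : r < 1).
Hypothesis gammaE : forall k, gamma k = g0 / Num.sqrt k.+1%:R.

Lemma sqrt_stepsize_powR a k :
  gamma k `^ a = g0 `^ a * (k.+1%:R : R) `^ (- (a / 2)).
Proof.
rewrite gammaE powRM ?(ltW g0_gt0) ?invr_ge0 ?sqrtr_ge0//; congr (_ * _).
by rewrite -powR12_sqrt// -powRN -powRrM; congr powR; lra.
Qed.

Lemma sqrt_stepsize_sum a K :
  \sum_(k < K) gamma k `^ a = g0 `^ a * powsum (1 - a / 2) K.
Proof.
rewrite /powsum mulr_sumr; apply: eq_bigr => k _; rewrite sqrt_stepsize_powR.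
by congr (_ * powR _ _); ring.
Qed.

Lemma sqrt_stepsize_bound (A W : R) K : 0 <= A -> 0 <= W -> (3 < K)%N ->
  (\sum_(k < K) gamma k `^ r)^-1 * (4 * gamma K.-1 `^ (r - 1) * A +
     (\sum_(k < K) gamma k `^ (r + 1)) * W) <=
  (2 - r) * 2 `^ (1 - r / 2) * (4 * A / g0 + g0 * W / (1 - r)) / Num.sqrt K%:R.
Proof.
move=> A0 W0 K3; have K0 : (0 < K)%N by apply: leq_trans K3.
rewrite !sqrt_stepsize_sum sqrt_stepsize_powR prednK//.
set s := 1 - r / 2; pose t := (1 - r) / 2.
have t0 : 0 < t by rewrite divr_gt0 ?subr_gt0.
have st : s = t + 1 / 2 by rewrite /s /t; lra.
have -> : 1 - (r + 1) / 2 = t by rewrite /t; lra.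
have -> : - ((r - 1) / 2) = t by rewrite /t; lra.
have h1 := @powsum_lower R s K; have h2 := powsum_ratio t0 K3.
have {}h1 : K%:R `^ s <= 2 * s * 2 `^ s * powsum s K by apply: h1; rewrite st; lra.
rewrite -st in h2; rewrite st -sqrt_powR// -st in h1.
have Ks : 0 < Num.sqrt (K%:R : R) by rewrite sqrtr_gt0 ltr0n.
have Kt : 0 < (K%:R : R) `^ t by apply: powR_gt0; rewrite ltr0n.
have S0 : 0 < powsum s K.
  rewrite lt_neqAle powsum_ge0 andbT; apply/eqP => S0.
  by move: h1; rewrite -S0 mulr0 leNgt mulr_gt0.
have gr : 0 < g0 `^ r by rewrite powR_gt0.
have -> : g0 `^ (r - 1) = g0 `^ r / g0.
  by rewrite powRB ?(gt_eqF g0_gt0) ?implybT// powRr1// ltW.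
have -> : g0 `^ (r + 1) = g0 `^ r * g0.
  by rewrite powRD ?(gt_eqF g0_gt0) ?implybT// powRr1// ltW.
move: (g0 `^ r) gr (2 `^ s) h1 h2 => G G0 q h1 h2.
have -> : 2 - r = 2 * s by rewrite /s; lra.
have -> : 1 - r = 2 * t by rewrite /t; lra.
rewrite ler_pdivlMr// -[leLHS]mulrA ler_pdivrMl ?mulr_gt0//.
rewrite -subr_ge0.
(* The difference of the two sides is a nonnegative combination of the slacks in [powsum_lower]
   (coefficient of [A]) and [powsum_ratio] (coefficient of [W]). *)
have -> : G * powsum s K * (2 * s * q * (4 * A / g0 + g0 * W / (2 * t))) -
  (4 * (G / g0 * K%:R `^ t) * A + G * g0 * powsum t K * W) * Num.sqrt K%:R =
  G * (4 * A / g0 * (2 * s * q * powsum s K - Num.sqrt K%:R * K%:R `^ t) +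
   g0 * W / t * (s * q * powsum s K - t * Num.sqrt K%:R * powsum t K)).
  by field; rewrite !gt_eqF.
apply: mulr_ge0; first exact: ltW.
apply: addr_ge0; apply: mulr_ge0; rewrite ?subr_ge0//.
- by apply: divr_ge0; [apply: mulr_ge0 => //|]; exact: ltW.
- by apply: divr_ge0; [apply: mulr_ge0 => //|]; exact: ltW.
Qed.

End SqrtStepsize.

Theorem proposition4 (R : realType) (d m : nat) (n : 'I_d -> nat)
  (d_gt0 : (0 < d)%N) (n_gt0 : forall i, (0 < n i)%N)
  (nrm : forall i, 'rV[R]_(n i) -> R) (nrm_norm : forall i, is_norm (nrm i))
  (* the feasible set *)
  (X : forall i, set 'rV[R]_(n i))
  (X_neq0 : forall i, X i !=set0) (X_closed : forall i, closed (X i))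
  (X_convex : forall i, convex_set (X i))
  (B : 'I_d -> R) (X_bounded : forall i x, X i x -> nrm i x <= B i)
  (* the distance-generating functions and their gradients *)
  (omega : forall i, 'rV[R]_(n i) -> R)
  (grad : forall i, 'rV[R]_(n i) -> 'rV[R]_(n i))
  (mu L : 'I_d -> R)
  (omega_C1 : forall i, C1_on (X i) (omega i) (grad i))
  (mu_gt0 : forall i, 0 < mu i) (L_ge0 : forall i, 0 <= L i)
  (omega_strongly_convex : forall i x y, X i x -> X i y ->
     omega i x + dot (grad i x) (y - x) + mu i / 2 * nrm i (x - y) ^+ 2
       <= omega i y)
  (omega_smooth : forall i x y, X i x -> X i y ->
     omega i y <=
       omega i x + dot (grad i x) (y - x) + L i / 2 * nrm i (x - y) ^+ 2)
  (* the random mapping, its mean, and the random samples *)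
  (dT : measure_display) (T : measurableType dT) (P : probability T R)
  (Phi : 'rV[R]_(\sum_i n i) -> 'rV[R]_m -> 'rV[R]_(\sum_i n i))
  (Phi_measurable : @measurable_fun _ _
     (borel_rV R (\sum_i n i) * borel_rV R m)%type (borel_rV R (\sum_i n i))
     (setprod X `*` setT) (fun p => Phi p.1 p.2))
  (xi : {RV P >-> borel_rV R m}) (xis xits : nat -> {RV P >-> borel_rV R m})
  (x0 : {RV P >-> borel_rV R (\sum_i n i)})
  (x0_in : forall w, setprod X (x0 w))
  (xis_law : forall k, same_distribution (xis k) xi)
  (xits_law : forall k, same_distribution (xits k) xi)
  (samples_independent : mutually_independent P (sample_sigma x0 xis xits))
  (F : 'rV[R]_(\sum_i n i) -> 'rV[R]_(\sum_i n i))
  (Phi_integrable : forall x j, setprod X x ->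
     P.-integrable setT (fun w => (Phi x (xi w) 0 j)%:E))
  (F_def : forall x, setprod X x ->
     F x = vec_expectation P (fun w => Phi x (xi w)))
  (F_monotone : forall x y, setprod X x -> setprod X y ->
     0 <= bdot (F x - F y) (x - y))
  (C : 'I_d -> R)
  (F_bounded : forall i x, setprod X x ->
     dual_norm (nrm i) (submxrow (F x) i) <= C i)
  (* (R2): unbiasedness *)
  (R2t : forall x k, setprod X x ->
     vec_expectation P (fun w => Phi x (xits k w)) = F x)
  (R2 : forall x k, setprod X x ->
     vec_expectation P (fun w => Phi x (xis k w)) = F x)
  (* (R3): bounded variance *)
  (nu nut : 'I_d -> R)
  (nu_gt0 : forall i, 0 < nu i) (nut_gt0 : forall i, 0 < nut i)
  (R3t : forall i k x, setprod X x ->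
     ('E_P[fun w => (dual_norm (nrm i)
              (submxrow (Phi x (xits k w)) i - submxrow (F x) i) ^+ 2)%R]
       <= (nut i ^+ 2)%:E)%E)
  (R3 : forall i k x, setprod X x ->
     ('E_P[fun w => (dual_norm (nrm i)
              (submxrow (Phi x (xis k w)) i - submxrow (F x) i) ^+ 2)%R]
       <= (nu i ^+ 2)%:E)%E)
  (* the stochastic mirror-prox iterates *)
  (r : R) (r_lt1 : r < 1)
  (gamma : nat -> R) (gamma_gt0 : forall k, 0 < gamma k)
  (gamma_nonincreasing : forall k, gamma k.+1 <= gamma k)
  (x y : nat -> T -> 'rV[R]_(\sum_i n i))
  (x_init : forall w, x 0%N w = x0 w)
  (y_step : forall k w i,
     submxrow (y k.+1 w) i =
       prox (X i) (omega i) (grad i) (submxrow (x k w) i)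
         (gamma k *: submxrow (Phi (x k w) (xits k w)) i))
  (x_step : forall k w i,
     submxrow (x k.+1 w) i =
       prox (X i) (omega i) (grad i) (submxrow (x k w) i)
         (gamma k *: submxrow (Phi (y k.+1 w) (xis k w)) i)) :
  (forall K : nat, (1 <= K)%N ->
     (\int[P]_w gap (setprod X) F (ybar gamma r (fun k => y k w) K)
      <= ((\sum_(k < K) gamma k `^ r)^-1 *
          (4 * gamma K.-1 `^ (r - 1) * (\sum_i L i * B i ^+ 2) +
           \sum_(k < K) gamma k `^ (r + 1) *
             \sum_i 2 / mu i *
               (2 * C i ^+ 2 + nut i ^+ 2 + 5 / 4 * nu i ^+ 2)))%:E)%E) /\
  (forall gamma0 : R, 0 < gamma0 ->
     (forall k : nat, gamma k = gamma0 / Num.sqrt (k.+1)%:R) ->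
   forall K : nat,
     Num.max (Num.ceil (((3 - r) / 2) `^ (2 / (1 - r)))) 3%:Z < K%:Z ->
     (\int[P]_w gap (setprod X) F (ybar gamma r (fun k => y k w) K)
      <= ((2 - r) * 2 `^ (1 - r / 2) *
          (4 * (\sum_i L i * B i ^+ 2) / gamma0 +
           gamma0 *
             (\sum_i 2 / mu i *
               (2 * C i ^+ 2 + nut i ^+ 2 + 5 / 4 * nu i ^+ 2)) / (1 - r))
          / Num.sqrt K%:R)%:E)%E).
Proof.
have y_step' k w : y k.+1 w =
    bprox X omega grad (x k w) (gamma k *: Phi (x k w) (xits k w)).
  by apply/mxrowP => i; rewrite y_step mxrowK submxrowZ.
have x_step' k w : x k.+1 w =
    bprox X omega grad (x k w) (gamma k *: Phi (y k.+1 w) (xis k w)).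
  by apply/mxrowP => i; rewrite x_step mxrowK submxrowZ.
have R3t' i k v : setprod X v ->
    ('E_P[fun w => (bdual nrm i (Phi v (xits k w) - F v) ^+ 2)%R] <= (nut i ^+ 2)%:E)%E.
  by move=> /R3t => /(_ i k); under eq_fun do rewrite -submxrowBE.
have R3' i k v : setprod X v ->
    ('E_P[fun w => (bdual nrm i (Phi v (xis k w) - F v) ^+ 2)%R] <= (nu i ^+ 2)%:E)%E.
  by move=> /R3 => /(_ i k); under eq_fun do rewrite -submxrowBE.
have gap_bound := expected_gap_le nrm_norm X_neq0 X_closed X_convex X_bounded
  omega_C1 mu_gt0 L_ge0 omega_strongly_convex omega_smooth Phi_measurable x0_in
  xis_law samples_independent Phi_integrable F_def F_monotone F_bounded R3t' R3'
  r_lt1 gamma_gt0 gamma_nonincreasing x_init y_step' x_step'.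
split=> [//|g0 g0_gt0 gammaE K].
rewrite gt_max => /andP[_ K3]; have {}K3 : (3 < K)%N by [].
apply: le_trans (gap_bound K (leq_trans _ K3)) _ => //.
rewrite lee_fin -mulr_suml; apply: sqrt_stepsize_bound => //.
- by apply: sumr_ge0 => i _; rewrite mulr_ge0// sqr_ge0.
- apply: sumr_ge0 => i _; rewrite mulr_ge0 ?divr_ge0 ?(ltW (mu_gt0 i))//.
  have := sqr_ge0 (C i); have := sqr_ge0 (nut i); have := sqr_ge0 (nu i); lra.
Qed.
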